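(* Let $m\ge1$, let $d=m$ or $d=11m$, and let $\Gamma=R_{12m}(3d+2,9d+1)$ be the Rose Window graph (with $3d+2$ and $9d+1$ reduced modulo $12m$). Then (i) if $m\not\equiv2\pmod4$, $\Gamma$ is the underlying graph of exactly three pairwise nonisomorphic maps of class $2_{\{0,1\}}$; (ii) if $m\equiv2\pmod4$, $\Gamma$ is the underlying graph of exactly two pairwise nonisomorphic maps of class $2_{\{0,1\}}$.
   Context: For $n\ge3$, $1\le r\le n-1$ with $r\ne n/2$, and $0\le a\le n-1$, the Rose Window graph $R_n(a,r)$ has vertex set $\{x_i,y_i: i\in\mathbb Z_n\}$ and edges $x_ix_{i+1}$, $y_iy_{i+r}$, $x_iy_i$, $x_iy_{i-a}$ for $i\in\mathbb Z_n$ (indices mod $n$). A map is a $2$-cell embedding of a connected simple graph (its underlying graph) in a closed surface; the components of the complement are the faces. All maps considered are polytopal: flags correspond bijectively to incident triples (vertex, edge, face). For a flag $\Phi$ and $i\in\{0,1,2\}$, $\Phi^i$ is the unique flag differing from $\Phi$ exactly in its vertex ($i=0$), edge ($i=1$) or face ($i=2$). $\mathrm{Aut}(\mathcal M)$ is the group of automorphisms of the underlying graph preserving the set of faces. A map is in class $2_{\{0,1\}}$ if $\mathrm{Aut}(\mathcal M)$ has exactly two orbits on flags and for every flag $\Phi$, the flags $\Phi^0,\Phi^1$ lie in the orbit of $\Phi$ while $\Phi^2$ does not. *)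

(* Defs.v *)
From mathcomp Require Import all_boot all_fingroup.
Unset Printing Implicit Defensive.

(* Vertices of R_n(a,r): (false, i) = x_i, (true, i) = y_i, i in Z_n. *)
Definition rw_vert (n : nat) : finType := (bool * 'I_n)%type.

(* Adjacency of R_n(a,r): x_i x_{i+1}, y_i y_{i+r}, x_i y_i, x_i y_{i-a}
   (indices mod n; a and r are assumed to be given already reduced mod n). *)
Definition rw_adj (n a r : nat) (u v : rw_vert n) : bool :=
  let i := nat_of_ord u.2 in
  let j := nat_of_ord v.2 in
  match u.1, v.1 with
  | false, false => (j == (i + 1) %% n) || (i == (j + 1) %% n)
  | true, true => (j == (i + r) %% n) || (i == (j + r) %% n)
  | false, true => (j == i) || (j == (i + (n - a)) %% n)
  | true, false => (i == j) || (i == (j + (n - a)) %% n)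
  end.

(* Edges as 2-element vertex sets; faces as sets of edges; maps as sets of faces. *)
Definition rw_edge (n a r : nat) (e : {set rw_vert n}) : bool :=
  [exists u : rw_vert n, exists v : rw_vert n,
     [&& u != v, rw_adj n a r u v & e == [set u; v]]].

Definition face_verts (n : nat) (f : {set {set rw_vert n}}) : {set rw_vert n} :=
  \bigcup_(e in f) e.

Definition is_cycle (n a r : nat) (f : {set {set rw_vert n}}) : bool :=
  [&& f != set0,
      [forall e in f, rw_edge n a r e],
      [forall v in face_verts n f, #|[set e in f | v \in e]| == 2] &
      [forall u in face_verts n f, forall v in face_verts n f,
         connect (fun x y : rw_vert n => [set x; y] \in f) u v]].

(* A polytopal map with underlying graph R_n(a,r), given by its set of faces:
   faces are cycles, every edge lies on exactly two faces, and the faces around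
   each vertex form a single cycle (connected vertex link). *)
Definition valid_map (n a r : nat) (M : {set {set {set rw_vert n}}}) : Prop :=
  (forall f, f \in M -> is_cycle n a r f) /\
  (forall e, rw_edge n a r e -> #|[set f in M | e \in f]| = 2) /\
  (forall v f g, f \in M -> g \in M -> v \in face_verts n f -> v \in face_verts n g ->
     connect (fun f1 f2 : {set {set rw_vert n}} =>
                [&& f1 \in M, f2 \in M &
                    [exists e : {set rw_vert n}, [&& v \in e, e \in f1 & e \in f2]]]) f g).

Definition graph_aut (n a r : nat) (s : {perm rw_vert n}) : Prop :=
  forall u v, rw_adj n a r (s u) (s v) = rw_adj n a r u v.

Definition img_face (n : nat) (s : {perm rw_vert n}) (f : {set {set rw_vert n}})
  : {set {set rw_vert n}} := [set s @: e | e : {set rw_vert n} in f].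

Definition img_map (n : nat) (s : {perm rw_vert n}) (M : {set {set {set rw_vert n}}})
  : {set {set {set rw_vert n}}} := [set img_face n s f | f : {set {set rw_vert n}} in M].

Definition map_aut (n a r : nat) (M : {set {set {set rw_vert n}}}) (s : {perm rw_vert n})
  : Prop := graph_aut n a r s /\ img_map n s M = M.

Definition flag_t (n : nat) : Type :=
  (rw_vert n * {set rw_vert n} * {set {set rw_vert n}})%type.

Definition is_flag (n : nat) (M : {set {set {set rw_vert n}}}) (F : flag_t n) : Prop :=
  [/\ F.2 \in M, F.1.2 \in F.2 & F.1.1 \in F.1.2].

Definition flag_act (n : nat) (s : {perm rw_vert n}) (F : flag_t n) : flag_t n :=
  (s F.1.1, s @: F.1.2, img_face n s F.2).

Definition same_orbit (n a r : nat) (M : {set {set {set rw_vert n}}}) (F G : flag_t n)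
  : Prop := exists s, map_aut n a r M s /\ flag_act n s F = G.

(* Class 2_{0,1}: exactly two flag orbits; Phi^0, Phi^1 in the orbit of Phi,
   Phi^2 not (Phi^i = a flag differing from Phi exactly in component i). *)
Definition class2_01 (n a r : nat) (M : {set {set {set rw_vert n}}}) : Prop :=
  valid_map n a r M /\
  (exists F1 F2, [/\ is_flag n M F1, is_flag n M F2, ~ same_orbit n a r M F1 F2 &
       forall G, is_flag n M G -> same_orbit n a r M F1 G \/ same_orbit n a r M F2 G]) /\
  (forall F G, is_flag n M F -> is_flag n M G ->
     G.1.1 <> F.1.1 -> G.1.2 = F.1.2 -> G.2 = F.2 -> same_orbit n a r M F G) /\
  (forall F G, is_flag n M F -> is_flag n M G ->
     G.1.1 = F.1.1 -> G.1.2 <> F.1.2 -> G.2 = F.2 -> same_orbit n a r M F G) /\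
  (forall F G, is_flag n M F -> is_flag n M G ->
     G.1.1 = F.1.1 -> G.1.2 = F.1.2 -> G.2 <> F.2 -> ~ same_orbit n a r M F G).

Definition map_iso (n a r : nat) (M M' : {set {set {set rw_vert n}}}) : Prop :=
  exists s, graph_aut n a r s /\ img_map n s M = M'.

Definition exactly_k_class2_01_maps (n a r k : nat) : Prop :=
  exists s : seq {set {set {set rw_vert n}}},
    [/\ size s = k,
        forall M, M \in s -> class2_01 n a r M,
        forall i j, i < k -> j < k -> map_iso n a r (nth set0 s i) (nth set0 s j) -> i = j &
        forall M, class2_01 n a r M -> exists2 M', M' \in s & map_iso n a r M M'].

(* Main.v *)
From Stdlib Require Import ZArith.
Require Import Defs.
From mathcomp Require Import all_boot all_fingroup.
From mathcomp Require Import zify.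

(** Give x_i the level i and y_i the level i + 1. Every edge joins consecutive
levels (modulo 3m), and every vertex has two neighbours on the next level and two
on the previous one. The four neighbours are indexed by (Z/2)^2, the first
coordinate telling up from down, so the three ways of pairing the edges at a vertex
are the three translations of (Z/2)^2. A map of class 2_{0,1} is a union of two
decompositions of the edge set into cycles, both stable under an arc-transitive
group, and a decomposition into cycles is the same thing as a choice of a pairing at
every vertex. An arc-transitive group generated by three explicit automorphisms acts
on the neighbours by translations, hence preserves the three constant choices, which
do consist of cycles. Counting walks shows that every automorphism preserves
the pairing (0, 1), i.e. up with up and down with down. Hence an automorphism
fixing an arc is determined level by level: it is the identity, or it is given by an
explicit formula which is consistent around the graph only if m = 2 modulo 4.
In the first case the maps are the three unions of two constant choices. In the second
case the extra automorphism swaps the pairings (1, 0) and (1, 1); one of the two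
decompositions must then be the constant choice (0, 1), and the other one is, up to
the extra automorphism, constantly (1, 0) or alternates between (1, 0) and (1, 1)
along the bipartition of the graph. *)

Unset Printing Implicit Defensive.

(** * Maps as unions of two cycle decompositions *)

Notation dir := (bool * bool)%type.

Definition dadd (i j : dir) : dir := (i.1 (+) j.1, i.2 (+) j.2).

Lemma daddC i j : dadd i j = dadd j i.
Proof. by case: i j => [[] []] [[] []]. Qed.

Lemma daddA i j k : dadd i (dadd j k) = dadd (dadd i j) k.
Proof. by case: i j k => [[] []] [[] []] [[] []]. Qed.

Lemma daddK i j : dadd (dadd i j) j = i.
Proof. by case: i j => [[] []] [[] []]. Qed.

Lemma daddKl i j : dadd i (dadd i j) = j.
Proof. by rewrite daddC (daddC i) daddK. Qed.

Lemma dadd_neq i t : t != (false, false) -> dadd i t != i.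
Proof. by case: i t => [[] []] [[] []]. Qed.

Lemma dadd_inj i : injective (dadd i).
Proof. by case: i => [[] []] [[] []] [[] []]. Qed.

(** A set of four points has exactly three perfect matchings, and the three nonzero translations of
    (Z/2)^2 realise them all. *)
Lemma involution_dadd (f : dir -> dir) :
  (forall i, f (f i) = i) -> (forall i, f i <> i) ->
  exists2 t, t != (false, false) & forall i, f i = dadd i t.
Proof.
move=> fK fN; exists (f (false, false)); first by apply/eqP/fN.
move=> i.
have := fK i; have := fN i; have := fK (false, false); have := fN (false, false).
have := fK (dadd i (f (false, false))); have := fN (dadd i (f (false, false))).
case: (f (false, false)) (erefl (f (false, false))) => [[] []] E1;
case: i => [[] []] //=; rewrite /dadd /= ?E1 //;
case E2: (f _) => [[] []] //; rewrite ?E1 ?E2 //;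
case E3: (f _) => [[] []] //; rewrite ?E1 ?E2 ?E3 //; congruence.
Qed.

(** These are the two linear automorphisms of (Z/2)^2 that fix (0,1), the vector of the pairing of
    up with up. The nontrivial one exchanges (1,0) and (1,1). *)
Definition shear (L : bool) (i : dir) : dir := (i.1, i.2 (+) (L && i.1)).

Lemma shear_dadd L i j : shear L (dadd i j) = dadd (shear L i) (shear L j).
Proof. by case: L i j => [] [[] []] [[] []]. Qed.

Lemma shearK L : involutive (shear L).
Proof. by case: L => [] [[] []]. Qed.

Lemma shear_comp L L' i : shear L' (shear L i) = shear (L (+) L') i.
Proof. by case: L L' i => [] [] [[] []]. Qed.

Lemma dadd_gen (P : dir -> Prop) t t' :
  t != (false, false) -> t' != (false, false) -> t <> t' -> P (false, false) ->
  (forall i, P i -> P (dadd i t)) -> (forall i, P i -> P (dadd i t')) -> forall i, P i.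
Proof.
move=> t0 t0' tt' P0 Pt Pt' i.
have Ptt := Pt' _ (Pt _ P0); have := Pt' _ P0; have := Pt _ P0.
by case: t t' i t0 t0' tt' Ptt {Pt Pt'} => [[] []] [[] []] [[] []].
Qed.

Lemma rw_adj_sym n a r (u v : rw_vert n) : rw_adj n a r u v = rw_adj n a r v u.
Proof.
by case: u v => [[] i] [[] j]; rewrite /rw_adj //= orbC.
Qed.

(** * Graphs whose neighbours at each vertex are indexed by (Z/2)^2 *)

Section PairingMaps.

Variables (n a r : nat) (nb : rw_vert n -> dir -> rw_vert n).
Local Notation T := (rw_vert n).
Local Notation adj := (rw_adj n a r).
Hypothesis adjE : forall u v, adj u v = [exists i, v == nb u i].
Hypothesis nb_inj : forall v, injective (nb v).
Hypothesis nb_neq : forall v i, nb v i != v.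

Implicit Types (v w : T) (i j : dir) (e : {set T}) (f : {set {set T}}).
Implicit Types (M : {set {set {set T}}}) (s : {perm T}).

Lemma adj_nb v i : adj v (nb v i).
Proof. by rewrite adjE; apply/existsP; exists i. Qed.

Lemma adjP u v : reflect (exists i, v = nb u i) (adj u v).
Proof.
rewrite adjE; apply: (iffP existsP) => [[i /eqP->]|[i ->]]; first by exists i.
by exists i.
Qed.

Lemma nb_rev v i : exists j, nb (nb v i) j = v.
Proof. by have := adj_nb v i; rewrite rw_adj_sym => /adjP[j e]; exists j. Qed.

Definition ed (v : T) (i : dir) : {set T} := [set v; nb v i].

Lemma mem_ed v i : v \in ed v i.
Proof. by rewrite set21. Qed.

Lemma mem_ed_nb v i : nb v i \in ed v i.
Proof. by rewrite set22. Qed.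

Lemma ed_rev v i j : nb (nb v i) j = v -> ed (nb v i) j = ed v i.
Proof. by move=> e; rewrite /ed e setUC. Qed.

Lemma ed_inj v : injective (ed v).
Proof.
move=> i j e; have := mem_ed_nb v i; rewrite e in_set2 (negPf (nb_neq v i)) /=.
by move/eqP/nb_inj.
Qed.

Lemma ed_eqP v i w j :
  ed v i = ed w j -> (v = w /\ i = j) \/ (w = nb v i /\ nb w j = v).
Proof.
move=> e; have : w \in ed v i by rewrite e mem_ed.
rewrite in_set2 => /orP[/eqP wv|/eqP wv]; first by left; subst; split=> //; exact: (ed_inj v).
right; split=> //; have : v \in ed w j by rewrite -e mem_ed.
rewrite in_set2 => /orP[/eqP vw|/eqP <-] //.
by have := nb_neq v i; rewrite -wv -vw eqxx.
Qed.

Lemma rw_edgeP e : reflect (exists v i, e = ed v i) (rw_edge n a r e).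
Proof.
apply: (iffP existsP) => [[u /existsP[v /and3P[_ /adjP[i ->] /eqP->]]]|[v [i ->]]].
  by exists u, i.
exists v; apply/existsP; exists (nb v i).
by rewrite eq_sym nb_neq adj_nb eqxx.
Qed.

Lemma rw_edge_ed v i : rw_edge n a r (ed v i).
Proof. by apply/rw_edgeP; exists v, i. Qed.

Lemma ed_at e w : rw_edge n a r e -> w \in e -> exists i, e = ed w i.
Proof.
case/rw_edgeP=> v [i ->]; rewrite in_set2 => /orP[/eqP->|/eqP->]; first by exists i.
by have [j /ed_rev <-] := nb_rev v i; exists j.
Qed.

(* The type tau v pairs the edges at v in the directions i and dadd i (tau v). *)
Definition pstep (tau : T -> dir) : rel {set T} := fun e e' =>
  [exists v, exists i, (e == ed v i) && (e' == ed v (dadd i (tau v)))].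

Fact face_key : unit.
Proof. exact: tt. Qed.

(* Locked, as unification would otherwise unfold [connect]. *)
Definition face : (T -> dir) -> {set T} -> {set {set T}} :=
  locked_with face_key (fun tau e => [set e' | connect (pstep tau) e e']).

Section Faces.

Variable tau : T -> dir.

Definition fmap : {set {set {set T}}} := [set face tau (ed p.1 p.2) | p : T * dir].

Lemma pstepP e e' :
  reflect (exists v i, e = ed v i /\ e' = ed v (dadd i (tau v))) (pstep tau e e').
Proof.
apply: (iffP existsP) => [[v /existsP[i /andP[/eqP-> /eqP->]]]|[v [i [-> ->]]]].
  by exists v, i.
by exists v; apply/existsP; exists i; rewrite !eqxx.
Qed.

Lemma pstep_ed v i : pstep tau (ed v i) (ed v (dadd i (tau v))).
Proof. by apply/pstepP; exists v, i. Qed.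

Lemma pstep_sym : connect_sym (pstep tau).
Proof.
apply: sym_connect_sym => e e'; apply/pstepP/pstepP => -[v [i [-> ->]]];
  by exists v, (dadd i (tau v)); rewrite daddK.
Qed.

Lemma mem_face e e' : (e' \in face tau e) = connect (pstep tau) e e'.
Proof. by rewrite /face locked_withE inE. Qed.

Lemma face_refl e : e \in face tau e.
Proof. by rewrite mem_face connect0. Qed.

Lemma face_eq e e' : e' \in face tau e -> face tau e' = face tau e.
Proof.
by rewrite mem_face => h; apply/setP=> x; rewrite !mem_face; apply/esym/(same_connect pstep_sym h).
Qed.

Lemma mem_face_dadd v i : ed v (dadd i (tau v)) \in face tau (ed v i).
Proof. by rewrite mem_face connect1 // pstep_ed. Qed.

Lemma face_dadd v i : face tau (ed v (dadd i (tau v))) = face tau (ed v i).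
Proof. exact: face_eq (mem_face_dadd v i). Qed.

Lemma fmapP f : reflect (exists v i, f = face tau (ed v i)) (f \in fmap).
Proof.
apply: (iffP imsetP) => [[[v i] _ ->]|[v [i ->]]]; first by exists v, i.
by exists (v, i).
Qed.

Lemma face_fmap v i : face tau (ed v i) \in fmap.
Proof. by apply/fmapP; exists v, i. Qed.

Lemma fmap_face f e : f \in fmap -> e \in f -> f = face tau e.
Proof. by case/fmapP=> v [i ->] /face_eq. Qed.

Lemma face_ind (P : {set T} -> Prop) e :
  P e -> (forall v i, P (ed v i) -> P (ed v (dadd i (tau v)))) ->
  forall e', e' \in face tau e -> P e'.
Proof.
move=> Pe PS e'; rewrite mem_face => /connectP[p]; elim: p e Pe => [|x p IH] e Pe /=.
  by move=> _ ->.
by case/andP=> /pstepP[v [i [ev xv]]]; apply: IH; rewrite xv; apply: PS; rewrite -ev.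
Qed.

Lemma face_edge v i e : e \in face tau (ed v i) -> rw_edge n a r e.
Proof. by move: e; apply: face_ind => *; apply: rw_edge_ed. Qed.

(** The closed trails obtained by following the pairing pass through each vertex at most once, which
    is what makes them cycles. *)
Definition separated : Prop :=
  forall v i j, ed v j \in face tau (ed v i) -> j = i \/ j = dadd i (tau v).

(** A certificate for separation: [c] is an edge colouring, read off at either end, that is constant
    along the pairing. Faces are then monochromatic, and a face cannot return to a vertex through
    the other pair, whose colour differs. *)
Lemma coloring_separated (C : eqType) (c : T -> dir -> C) :
  (forall v i j, nb (nb v i) j = v -> c (nb v i) j = c v i) ->
  (forall v i, c v (dadd i (tau v)) = c v i) ->
  (forall v i j, c v i = c v j -> j = i \/ j = dadd i (tau v)) ->
  separated.
Proof.
move=> cR cT cS v i j h.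
have cE u k w l : ed u k = ed w l -> c u k = c w l.
  by move=> /ed_eqP[[-> ->]//|[e1 e2]]; subst w; rewrite (cR _ _ _ e2).
suff: exists w l, ed v j = ed w l /\ c w l = c v i.
  by case=> w [l [/cE <-]] /esym/cS.
move: h; apply: (face_ind (fun e => exists w l, e = ed w l /\ c w l = c v i)).
  by exists v, i.
move=> w l [u [k [/cE e1 e2]]]; exists w, (dadd l (tau w)); split=> //.
by rewrite cT e1.
Qed.

Hypothesis tau_neq0 : forall v, tau v != (false, false).
Hypothesis sep : separated.

Lemma face_at f v i :
  f \in fmap -> ed v i \in f ->
  [set e in f | v \in e] = [set ed v i; ed v (dadd i (tau v))].
Proof.
move=> fM vf; rewrite (fmap_face _ _ fM vf); apply/setP=> e; rewrite !inE.
apply/andP/orP=> [[h ve]|[/eqP->|/eqP->]]; last 2 first.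
- by rewrite face_refl mem_ed.
- by rewrite mem_face_dadd mem_ed.
have [j ej] : exists j, e = ed v j by apply: ed_at => //; apply: face_edge h.
by subst e; case: (sep v i j h) => ->; rewrite eqxx; [left|right].
Qed.

Lemma is_cycle_fmap f : f \in fmap -> is_cycle n a r f.
Proof.
move=> fM; have [v0 [i0 fE]] := fmapP _ fM; apply/and4P; split.
- by apply/set0Pn; exists (ed v0 i0); rewrite fE face_refl.
- by apply/forallP=> e; apply/implyP; rewrite fE; apply: face_edge.
- apply/forallP=> v; apply/implyP=> /bigcupP[e ef ve].
  have [i ei] : exists i, e = ed v i.
    by apply: ed_at => //; apply: (face_edge v0 i0); rewrite -fE.
  rewrite ei in ef; rewrite (face_at _ _ _ fM ef) cards2.
  by rewrite (inj_eq (ed_inj v)) (eq_sym i) (dadd_neq _ _ (tau_neq0 v)).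
apply/forallP=> u; apply/implyP=> /bigcupP[e ef ue].
apply/forallP=> w; apply/implyP=> /bigcupP[e' ef' we'].
have fsub x : x \in f -> face tau x = f by move/(fmap_face _ _ fM).
have key x y z : x \in f -> y \in x -> z \in x ->
    connect (fun p q : T => [set p; q] \in f) y z.
  move=> xf yx zx; have [y_z|y_z] := eqVneq y z; first by rewrite y_z connect0.
  have [i xi] : exists i, x = ed y i.
    by apply: ed_at => //; apply: (face_edge v0 i0); rewrite -fE.
  move: zx; rewrite xi in_set2 eq_sym (negPf y_z) /= => /eqP->.
  by apply: connect1; rewrite -/(ed y i) -xi.
have : e' \in face tau e by rewrite (fsub _ ef).
suff P : forall x, x \in face tau e ->
    x \in f /\ forall z, z \in x -> connect (fun p q : T => [set p; q] \in f) u z.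
  by case/P=> _; apply.
apply: face_ind => [|v i [xf IH]]; first by split=> // z; apply: key ef ue.
have xf' : ed v (dadd i (tau v)) \in f.
  by rewrite -(fsub _ xf) mem_face_dadd.
split=> // z zx; apply: connect_trans (IH v (mem_ed _ _)) _.
exact: key xf' (mem_ed _ _) zx.
Qed.

End Faces.

(** * Action of automorphisms on faces, maps and flags *)

Lemma graph_autV s : graph_aut n a r s -> graph_aut n a r s^-1.
Proof. by move=> h u v; rewrite -h !permKV. Qed.

Lemma graph_autM s (t : {perm T}) : graph_aut n a r s -> graph_aut n a r t -> graph_aut n a r (s * t).
Proof. by move=> hs ht u v; rewrite !permM ht hs. Qed.

Lemma imsetVK (s : {perm T}) (e : {set T}) : s^-1%g @: (s @: e) = e.
Proof. by rewrite -imset_comp (eq_imset (g := id)) ?imset_id // => x /=; rewrite permK. Qed.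

Lemma imsetKV (s : {perm T}) (e : {set T}) : s @: (s^-1%g @: e) = e.
Proof. by rewrite -imset_comp (eq_imset (g := id)) ?imset_id // => x /=; rewrite permKV. Qed.

Lemma img_face1 f : img_face n 1 f = f.
Proof.
rewrite /img_face (eq_imset (g := id)) ?imset_id // => e /=.
by rewrite (eq_imset (g := id)) ?imset_id // => x; rewrite perm1.
Qed.

Lemma img_faceM s (t : {perm T}) f : img_face n (s * t) f = img_face n t (img_face n s f).
Proof.
rewrite /img_face -imset_comp; apply: eq_imset => e /=.
by rewrite -imset_comp; apply: eq_imset => x; rewrite permM.
Qed.

Lemma img_faceK s : cancel (img_face n s) (img_face n s^-1).
Proof. by move=> f; rewrite -img_faceM mulgV img_face1. Qed.

Lemma img_faceKV s : cancel (img_face n s^-1) (img_face n s).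
Proof. by move=> f; rewrite -img_faceM mulVg img_face1. Qed.

Lemma img_map1 M : img_map n 1 M = M.
Proof. by rewrite /img_map (eq_imset (g := id)) ?imset_id // => f; rewrite img_face1. Qed.

Lemma img_mapM s (t : {perm T}) M : img_map n (s * t) M = img_map n t (img_map n s M).
Proof. by rewrite /img_map -imset_comp; apply: eq_imset => f; rewrite img_faceM. Qed.

Lemma img_mapU s M N : img_map n s (M :|: N) = img_map n s M :|: img_map n s N.
Proof. exact: imsetU. Qed.

Lemma mem_img_face (s : {perm T}) (f : {set {set T}}) (e : {set T}) :
  e \in f -> s @: e \in img_face n s f.
Proof. exact: imset_f. Qed.

Lemma mem_img_map s M f : f \in M -> img_face n s f \in img_map n s M.
Proof. exact: imset_f. Qed.

Lemma map_autV M s : map_aut n a r M s -> map_aut n a r M s^-1.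
Proof.
case=> hs sM; split; first exact: graph_autV.
by rewrite -{1}sM -img_mapM mulgV img_map1.
Qed.

Lemma map_autM M s (t : {perm T}) : map_aut n a r M s -> map_aut n a r M t -> map_aut n a r M (s * t).
Proof.
case=> hs sM [ht tM]; split; first exact: graph_autM.
by rewrite img_mapM sM.
Qed.

Lemma flag_actM s (t : {perm T}) F : flag_act n (s * t) F = flag_act n t (flag_act n s F).
Proof.
rewrite /flag_act /= permM img_faceM -imset_comp.
by congr (_, _, _); apply: eq_imset => x; rewrite permM.
Qed.

Lemma flag_act1 F : flag_act n 1 F = F.
Proof.
case: F => [[v e] f]; rewrite /flag_act /= perm1 img_face1.
by rewrite (eq_imset (g := id)) ?imset_id // => x; rewrite perm1.
Qed.

Lemma same_orbit_refl M F : same_orbit n a r M F F.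
Proof.
exists 1%g; split; last exact: flag_act1.
by split; [move=> u v; rewrite !perm1|exact: img_map1].
Qed.

Lemma same_orbit_sym M F G : same_orbit n a r M F G -> same_orbit n a r M G F.
Proof.
case=> s [hs <-]; exists s^-1%g; split; first exact: map_autV.
by rewrite -flag_actM mulgV flag_act1.
Qed.

Lemma same_orbit_trans M F G H :
  same_orbit n a r M F G -> same_orbit n a r M G H -> same_orbit n a r M F H.
Proof.
move=> [s [hs <-]] [t [ht <-]]; exists (s * t)%g; split; first exact: map_autM.
by rewrite flag_actM.
Qed.

Lemma is_flag_act M s F : map_aut n a r M s -> is_flag n M F -> is_flag n M (flag_act n s F).
Proof.
move=> [_ sM] [fM ef ve]; split=> /=; last exact: imset_f.
  by rewrite -sM; apply: mem_img_map.
exact: mem_img_face.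
Qed.

Lemma map_iso_refl M : map_iso n a r M M.
Proof.
by exists 1%g; split; [move=> u v; rewrite !perm1|exact: img_map1].
Qed.

(** On directions, [s] acts at each vertex by an affine map of (Z/2)^2. The translation part may
    vary with the vertex, the linear part [shear L] may not. *)
Definition affine (L : bool) (s : {perm T}) : Prop :=
  forall v, exists k, forall i, s (nb v i) = nb (s v) (dadd k (shear L i)).

Lemma affine_aut L s : affine L s -> graph_aut n a r s.
Proof.
move=> hs u v; apply/adjP/adjP=> [[i e]|[i ->]]; last first.
  by have [k ->] := hs u; exists (dadd k (shear L i)).
have [k hk] := hs u; exists (shear L (dadd k i)); apply: (@perm_inj _ s).
by rewrite hk shearK daddKl.
Qed.

Lemma affineM L L' s (t : {perm T}) : affine L s -> affine L' t -> affine (L (+) L') (s * t).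
Proof.
move=> hs ht v; have [k hk] := hs v; have [l hl] := ht (s v).
exists (dadd l (shear L' k)) => i.
by rewrite !permM hk hl shear_dadd shear_comp daddA.
Qed.

Lemma affineV L s : affine L s -> affine L s^-1.
Proof.
move=> hs v; have [k hk] := hs (s^-1%g v); exists (shear L k) => i.
apply: (@perm_inj _ s); rewrite permKV hk permKV shear_dadd !shearK.
by rewrite daddKl.
Qed.

Lemma imset_ed (s : {perm T}) v i : s @: ed v i = [set s v; s (nb v i)].
Proof. by rewrite /ed imsetU1 imset_set1. Qed.

Lemma imset_ed_nb (s : {perm T}) v i j : s (nb v i) = nb (s v) j -> s @: ed v i = ed (s v) j.
Proof. by rewrite imset_ed => ->. Qed.

Lemma imset_ed_eq (s : {perm T}) v i w j :
  s v = w -> s @: ed v i = ed w j -> s (nb v i) = nb w j.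
Proof.
move=> <-; rewrite imset_ed => e; have : s (nb v i) \in ed (s v) j by rewrite -e set22.
by rewrite in_set2 (inj_eq perm_inj) (negPf (nb_neq v i)) => /eqP.
Qed.

(** Translations commute with one another, so only the linear part of [s] alters the vector of a
    pairing. *)
Lemma mem_face_img L s tau tau' e e' :
  affine L s -> (forall v, tau' (s v) = shear L (tau v)) ->
  e' \in face tau e -> s @: e' \in face tau' (s @: e).
Proof.
move=> hs ht; move: e'; apply: face_ind => [|v i IH]; first exact: face_refl.
have [k hk] := hs v; move: IH; rewrite !(imset_ed_nb _ _ _ _ (hk _)) => /face_eq <-.
by rewrite shear_dadd daddA -ht mem_face_dadd.
Qed.

Lemma img_face_face L s tau tau' e :
  affine L s -> (forall v, tau' (s v) = shear L (tau v)) ->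
  img_face n s (face tau e) = face tau' (s @: e).
Proof.
move=> hs ht; apply/setP=> e'; apply/imsetP/idP => [[x xe ->]|h].
  exact: mem_face_img hs ht xe.
exists (s^-1%g @: e'); last by rewrite imsetKV.
rewrite -(imsetVK s e); apply: (mem_face_img L _ tau') h; first exact: affineV.
by move=> v; rewrite -[in RHS](permKV s v) ht shearK.
Qed.

Lemma img_fmap L s tau tau' :
  affine L s -> (forall v, tau' (s v) = shear L (tau v)) ->
  img_map n s (fmap tau) = fmap tau'.
Proof.
move=> hs ht; apply/setP=> f; apply/imsetP/fmapP => [[g /fmapP[v [i ->]] ->]|[w [j ->]]].
  have [k hk] := hs v; exists (s v), (dadd k (shear L i)).
  by rewrite (img_face_face L s tau tau') // (imset_ed_nb _ _ _ _ (hk _)).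
have [k hk] := affineV _ _ hs w.
exists (face tau (ed (s^-1%g w) (dadd k (shear L j)))); first exact: face_fmap.
by rewrite (img_face_face L s tau tau') // -(imset_ed_nb _ _ _ _ (hk _)) imsetKV.
Qed.

(** A common face leaves [v] through a single second edge, and both pairings have to produce it. *)
Lemma fmap_agree tau tau' f v i :
  tau v != (false, false) -> separated tau' ->
  f \in fmap tau -> f \in fmap tau' -> ed v i \in f -> tau v = tau' v.
Proof.
move=> t0 sep' fM fM' vf; have := vf; rewrite (fmap_face _ _ _ fM' vf) => vf'.
have : ed v (dadd i (tau v)) \in face tau' (ed v i).
  by rewrite -(fmap_face _ _ _ fM' vf) (fmap_face _ _ _ fM vf) mem_face_dadd.
case/sep' => [e|/dadd_inj //].
by have := dadd_neq i _ t0; rewrite e eqxx.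
Qed.

Lemma fmap_inj tau tau' :
  (forall v, tau v != (false, false)) -> separated tau' ->
  fmap tau = fmap tau' -> forall v, tau v = tau' v.
Proof.
move=> t0 sep' e v; have fM := face_fmap tau v (false, false).
have fM' := fM; rewrite e in fM'.
exact: fmap_agree (t0 v) sep' fM fM' (face_refl _ _).
Qed.

Lemma eq_fmap tau tau' : tau =1 tau' -> fmap tau = fmap tau'.
Proof.
move=> e; have es : pstep tau =2 pstep tau'.
  by move=> x y; apply: eq_existsb => v; apply: eq_existsb => i; rewrite e.
have ec := eq_connect es.
have fs x : face tau x = face tau' x.
  by apply/setP=> y; exact: etrans (mem_face tau x y) (etrans (ec x y) (esym (mem_face tau' x y))).
by rewrite /fmap; apply: eq_imset => p; rewrite fs.
Qed.

(** * From cycle decompositions to pairings *)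

Lemma is_cycle_edge f e : is_cycle n a r f -> e \in f -> rw_edge n a r e.
Proof. by case/and4P=> _ /forallP h _ _ ef; have := h e; rewrite ef. Qed.

Lemma is_cycle_at f v i :
  is_cycle n a r f -> ed v i \in f ->
  exists j, [/\ j <> i, ed v j \in f & forall k, ed v k \in f -> k = i \/ k = j].
Proof.
move=> cf vf; have /and4P[_ _ /forallP h _] := cf.
have vV : v \in face_verts n f by apply/bigcupP; exists (ed v i); rewrite ?mem_ed.
have := h v; rewrite vV /= => /cards2P[x [y [xy E]]].
have mem k : ed v k \in f = (ed v k \in [set x; y]) by rewrite -E inE mem_ed andbT.
have two z : z \in [set x; y] -> exists j, z = ed v j.
  by rewrite -E inE => /andP[zf vz]; apply: ed_at => //; apply: is_cycle_edge cf zf.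
have [p xp] := two x (set21 _ _); have [q yq] := two y (set22 _ _).
have pq : p <> q by move=> pq; rewrite xp yq pq eqxx in xy.
have mem' k : ed v k \in f = (k == p) || (k == q).
  by rewrite mem in_set2 xp yq !(inj_eq (ed_inj v)).
move: vf; rewrite mem' => /orP[] /eqP->.
  exists q; split=> [e||k]; first by apply: pq.
    by rewrite mem' eqxx orbT.
  by rewrite mem' => /orP[] /eqP; [left|right].
exists p; split=> [e||k]; first by apply: pq.
  by rewrite mem' eqxx.
by rewrite mem' => /orP[] /eqP; [right|left].
Qed.

Lemma is_cycle_ind (P : T -> Prop) f v e :
  is_cycle n a r f -> e \in f -> v \in e -> P v ->
  (forall u w, P u -> [set u; w] \in f -> P w) ->
  forall w e', e' \in f -> w \in e' -> P w.
Proof.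
move=> /and4P[_ _ _ /forallP h] ef ve Pv PS w e' ef' we'.
have vV : v \in face_verts n f by apply/bigcupP; exists e.
have wV : w \in face_verts n f by apply/bigcupP; exists e'.
have := h v; rewrite vV => /forallP/(_ w); rewrite wV /= => /connectP[p].
elim: p v Pv {ve vV} => [|x p IH] v Pv /=; first by move=> _ ->.
by case/andP=> /(PS _ _ Pv)/IH.
Qed.

Definition decomposition (N : {set {set {set T}}}) : Prop :=
  (forall f, f \in N -> is_cycle n a r f) /\
  (forall e, rw_edge n a r e ->
     exists f, [/\ f \in N, e \in f & forall g, g \in N -> e \in g -> g = f]).

Lemma decomposition_separated tau :
  (forall v, tau v != (false, false)) -> decomposition (fmap tau) -> separated tau.
Proof.
move=> t0 [cyc _] v i j vj.
have cf := cyc _ (face_fmap tau v i).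
have [k [ki vk K]] := is_cycle_at _ _ _ cf (face_refl _ _).
have vt : ed v (dadd i (tau v)) \in face tau (ed v i).
  by rewrite mem_face_dadd.
have [e|->] := K _ vt; last exact: K.
by have := dadd_neq i _ (t0 v); rewrite e eqxx.
Qed.

(** At a vertex, passing from an edge to the other edge of its cycle is a fixed-point free
    involution of the four directions, hence a translation. Its vector is the type of the vertex. *)
Lemma decomposition_fmap (N : {set {set {set T}}}) :
  decomposition N ->
  exists2 tau : T -> dir, (forall v, tau v != (false, false)) & N = fmap tau.
Proof.
move=> [cyc cov].
pose Q v i j := (j != i) && [exists f in N, (ed v i \in f) && (ed v j \in f)].
(* This is the direction in which the cycle through [ed v i] leaves [v]. The default [i] is never
   taken, since every cycle has a second edge at [v]. *)
pose phi v i := odflt i [pick j | Q v i j].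
have phiP v i : [/\ phi v i <> i, forall f, f \in N -> ed v i \in f -> ed v (phi v i) \in f &
    forall f k, f \in N -> ed v i \in f -> ed v k \in f -> k = i \/ k = phi v i].
  have [f [fN vf fU]] := cov _ (rw_edge_ed v i).
  have [j [ji vj J]] := is_cycle_at _ _ _ (cyc _ fN) vf.
  have -> : phi v i = j.
    rewrite /phi; case: pickP => [k /andP[/eqP ki /existsP[g /and3P[gN vg kg]]]|/(_ j)] /=.
      by rewrite (fU _ gN vg) in kg; case: (J _ kg).
    rewrite /Q (introF eqP ji) /= => /existsP[]; exists f.
    by rewrite fN vf vj.
  by split=> // [g gN|g k gN] /(fU _ gN)-> //; apply: J.
have phiK v i : phi v (phi v i) = i.
  have [f [fN vf _]] := cov _ (rw_edge_ed v i).
  have [pN pf _] := phiP v i; have [qN qf qU] := phiP v (phi v i).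
  by have [/esym e|/esym //] := qU f i fN (pf f fN vf) vf; case: pN.
pose tau v := phi v (false, false).
have phiE v i : tau v != (false, false) /\ phi v i = dadd i (tau v).
  have [|t t0 tE] := involution_dadd (phi v) (phiK v); first by move=> j; case: (phiP v j).
  by have -> : tau v = t by rewrite /tau tE; case: (t) => [[] []].
exists tau; first by move=> v; case: (phiE v (false, false)).
(* A cycle of [N] is closed under the pairing, which gives one inclusion. Connectedness of the
   cycle, followed vertex by vertex, gives the other. *)
have key f e : f \in N -> e \in f -> f = face tau e.
  move=> fN ef; have cf := cyc _ fN.
  have ee := is_cycle_edge _ _ cf ef; have /rw_edgeP[v [i ei]] := ee.
  apply/setP=> x; apply/idP/idP; last first.
    move: x; apply: face_ind => // w j wj; have [_ <-] := phiE w j.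
    by have [_ pf _] := phiP w j; apply: pf.
  have st y w : y \in f -> y \in face tau e -> w \in y ->
      forall z, z \in f -> w \in z -> z \in face tau e.
    move=> yf ye wy z zf wz.
    have [j yj] := ed_at _ _ (is_cycle_edge _ _ cf yf) wy.
    have [k zk] := ed_at _ _ (is_cycle_edge _ _ cf zf) wz.
    have [_ _ pU] := phiP w j; rewrite -(face_eq _ _ _ ye); subst y z.
    have [->|->] := pU f k fN yf zf; first exact: face_refl.
    by have [_ ->] := phiE w j; rewrite mem_face_dadd.
  move=> xf; have /rw_edgeP[w [j xj]] := is_cycle_edge _ _ cf xf.
  have wx : w \in x by rewrite xj mem_ed.
  have ve : v \in e by rewrite ei mem_ed.
  apply: (is_cycle_ind (fun u => forall z, z \in f -> u \in z -> z \in face tau e) f v e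
            cf ef ve _ _ w x xf wx x xf wx).
    by apply: (st e) => //; apply: face_refl.
  by move=> u u' Pu uu'; apply: (st [set u; u']); rewrite ?set22 ?Pu ?set21.
apply/setP=> f; apply/idP/fmapP => [fN|[v [i ->]]].
  have /and4P[/set0Pn[e ef] _ _ _] := cyc _ fN.
  have /rw_edgeP[v [i ei]] := is_cycle_edge _ _ (cyc _ fN) ef.
  by exists v, i; rewrite -ei; apply: key.
by have [g [gN vg _]] := cov _ (rw_edge_ed v i); rewrite -(key g).
Qed.

(** * Two disjoint pairings define a map of class 2_{0,1} *)

Section Union.

Variables tau tau' : T -> dir.
Hypotheses (tau0 : forall v, tau v != (false, false)) (sep : separated tau).
Hypotheses (tau0' : forall v, tau' v != (false, false)) (sep' : separated tau').
Hypothesis tau_neq : forall v, tau v <> tau' v.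

Local Notation M := (fmap tau :|: fmap tau').

Lemma face_neq v i : face tau (ed v i) <> face tau' (ed v i).
Proof.
move=> e; apply: (tau_neq v); have fM := face_fmap tau v i.
have fM' : face tau (ed v i) \in fmap tau' by rewrite e face_fmap.
exact: fmap_agree (tau0 v) sep' fM fM' (face_refl _ _).
Qed.

Lemma mem_union f v i :
  f \in M -> ed v i \in f -> f = face tau (ed v i) \/ f = face tau' (ed v i).
Proof. by case/setUP=> fM vf; [left|right]; apply: fmap_face. Qed.

Lemma valid_map_union : valid_map n a r M.
Proof.
have fM v i : face tau (ed v i) \in M by rewrite inE face_fmap.
have fM' v i : face tau' (ed v i) \in M by rewrite inE face_fmap orbT.
split; first by move=> f /setUP[]; apply: is_cycle_fmap.
split=> [e /rw_edgeP[v [i ->]]|v f g fN gN vf vg].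
  have -> : [set f in M | ed v i \in f] = [set face tau (ed v i); face tau' (ed v i)].
    apply/setP=> f; rewrite inE in_set2; apply/andP/orP=> [[fN vf]|[]/eqP->].
    - by case: (mem_union _ _ _ fN vf) => ->; rewrite eqxx; [left|right].
    - by split; [exact: fM|exact: face_refl].
    - by split; [exact: fM'|exact: face_refl].
  by rewrite cards2; case: eqP => // /face_neq.
set R := (fun f1 f2 : {set {set T}} => _).
have Rsym : connect_sym R.
  apply: sym_connect_sym => x y; rewrite /R; apply/and3P/and3P => -[h1 h2 /existsP[e /and3P[a1 a2 a3]]];
    by split=> //; apply/existsP; exists e; apply/and3P.
have RF i : connect R (face tau (ed v i)) (face tau' (ed v i)).
  apply/connect1/and3P; split; [exact: fM|exact: fM'|apply/existsP; exists (ed v i)].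
  by apply/and3P; split; [exact: mem_ed|exact: face_refl|exact: face_refl].
(* The two faces on an edge are adjacent in the link, so one can move from direction i to i +
   [tau v] and to i + [tau' v]. These two vectors span (Z/2)^2, and the link is connected. *)
have all0 : forall i, connect R (face tau (ed v (false, false))) (face tau (ed v i)).
  apply: (dadd_gen _ (tau v) (tau' v)) => // [i|i h]; first by rewrite face_dadd.
  apply: (connect_trans h); apply: (connect_trans (RF i)).
  by rewrite -(face_dadd tau') Rsym; apply: RF.
have all1 h : h \in M -> v \in face_verts n h -> connect R (face tau (ed v (false, false))) h.
  move=> hN /bigcupP[e eh ve].
  have [i ei] : exists i, e = ed v i.
    have ch : is_cycle n a r h by move: hN => /setUP[]; apply: is_cycle_fmap.
    by apply: ed_at => //; apply: is_cycle_edge ch eh.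
  rewrite ei in eh; case: (mem_union _ _ _ hN eh) => ->; first exact: all0.
  exact: connect_trans (all0 i) (RF i).
by apply: (connect_trans (y := face tau (ed v (false, false)))); rewrite ?[connect R f _]Rsym; apply: all1.
Qed.

Hypothesis trans : forall v i w j, exists s L,
  [/\ affine L s, s v = w, s (nb v i) = nb w j,
      forall u, tau (s u) = shear L (tau u) & forall u, tau' (s u) = shear L (tau' u)].
Hypothesis noswap : forall s, graph_aut n a r s ->
  exists L, affine L s /\ forall v, tau' (s v) <> shear L (tau v).

(** A flag is an arc together with one of the two families of faces. By [trans] each family gives
    one flag orbit, and [noswap] keeps the orbits apart. Changing vertex or edge keeps the face and
    hence the family; changing the face changes the family. *)
Lemma class2_01_union (v0 : T) : class2_01 n a r M.
Proof.
have maut s L : affine L s -> (forall u, tau (s u) = shear L (tau u)) ->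
    (forall u, tau' (s u) = shear L (tau' u)) -> map_aut n a r M s.
  move=> hs h h'; split; first exact: affine_aut hs.
  by rewrite img_mapU (img_fmap L s tau tau) // (img_fmap L s tau' tau').
have flagE F : is_flag n M F -> exists v i,
    F = (v, ed v i, face tau (ed v i)) \/ F = (v, ed v i, face tau' (ed v i)).
  case: F => [[v e] f] [/= fN ef ve].
  have cf : is_cycle n a r f by move: fN => /setUP[]; apply: is_cycle_fmap.
  have [i ei] := ed_at _ _ (is_cycle_edge _ _ cf ef) ve; subst e; exists v, i.
  by case: (mem_union _ _ _ fN ef) => <-; [left|right].
have orb v i w j : same_orbit n a r M (v, ed v i, face tau (ed v i)) (w, ed w j, face tau (ed w j)).
  have [s [L [hs sv si h h']]] := trans v i w j; exists s; split; first exact: maut hs h h'.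
  rewrite /flag_act /= (img_face_face L s tau tau) // -sv.
  by rewrite (imset_ed_nb s v i j) // sv.
have orb' v i w j : same_orbit n a r M (v, ed v i, face tau' (ed v i)) (w, ed w j, face tau' (ed w j)).
  have [s [L [hs sv si h h']]] := trans v i w j; exists s; split; first exact: maut hs h h'.
  rewrite /flag_act /= (img_face_face L s tau' tau') // -sv.
  by rewrite (imset_ed_nb s v i j) // sv.
have norb v i w j : ~ same_orbit n a r M (v, ed v i, face tau (ed v i)) (w, ed w j, face tau' (ed w j)).
  case=> s [[hs _] [sv sj sf]]; have [L [aL nL]] := noswap s hs; apply: (nL v).
  (* The pairing [tau] transported by [s]: the image face is a face of [t2]. Being also a face of
     [tau'], it forces the two pairings to agree at [w]. *)
  pose t2 u := shear L (tau (s^-1%g u)).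
  have t2s u : t2 (s u) = shear L (tau u) by rewrite /t2 permK.
  rewrite (img_face_face L s tau t2) // sj in sf.
  have fM : face t2 (ed w j) \in fmap t2 by exact: face_fmap.
  have fM' : face t2 (ed w j) \in fmap tau' by rewrite sf face_fmap.
  have t2w : t2 w != (false, false).
    by rewrite -sv /= t2s; have := tau0 v; case: (tau v) (L) => [[] []] [].
  have := fmap_agree t2 tau' _ w j t2w sep' fM fM' (face_refl _ _).
  by rewrite -sv /= t2s.
split; first exact: valid_map_union.
split.
  exists (v0, ed v0 (false, false), face tau (ed v0 (false, false))).
  exists (v0, ed v0 (false, false), face tau' (ed v0 (false, false))).
  split.
  - by split; rewrite /= ?face_refl ?mem_ed // inE face_fmap.
  - by split; rewrite /= ?face_refl ?mem_ed // inE face_fmap orbT.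
  - exact: norb.
  by move=> G /flagE[v [i [->|->]]]; [left|right].
split.
  move=> F G /flagE[v [i [->|->]]] /flagE[w [j [->|->]]] //= _ eE fE.
    by case: (face_neq v i); rewrite -fE -eE.
  by case: (face_neq v i); rewrite -fE -eE.
split.
  move=> F G /flagE[v [i [->|->]]] /flagE[w [j [->|->]]] //= _ _ fE.
    have fM := face_fmap tau v i; have fM' := face_fmap tau' w j; rewrite fE in fM'.
    by case: (tau_neq v); apply: fmap_agree fM fM' (face_refl _ _).
  have fM := face_fmap tau' v i; have fM' := face_fmap tau w j; rewrite fE in fM'.
  by case: (tau_neq v); apply/esym; apply: fmap_agree fM fM' (face_refl _ _).
move=> F G /flagE[v [i [->|->]]] /flagE[w [j [->|->]]] //= _ eE.
- by case; rewrite eE.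
- by move=> _ /same_orbit_sym; apply: norb.
by case; rewrite eE.
Qed.

End Union.

(** All flags on one face are equivalent, since changes of vertex and edge stay in the orbit. So the
    two flag orbits split the faces into two families, and because a change of face leaves the
    orbit, every edge has one face in each. *)
Lemma class2_01_decomposition M :
  class2_01 n a r M ->
  exists A B : {set {set {set T}}},
    [/\ M = A :|: B, decomposition A, decomposition B, A <> B &
        (forall v i w j, exists s, [/\ map_aut n a r M s, s v = w & s (nb v i) = nb w j]) /\
        (forall s, map_aut n a r M s -> img_map n s A = A /\ img_map n s B = B)].
Proof.
case=> [[cyc [two _]] [[F1 [F2 [fl1 fl2 n12 cov]]] [c0 [c1 c2]]]].
pose autb (s : {perm T}) :=
  [forall u, forall v, adj (s u) (s v) == adj u v] && (img_map n s M == M).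
have autP s : reflect (map_aut n a r M s) (autb s).
  apply: (iffP andP) => -[h1 /eqP h2]; split=> //.
    by move=> u v; have /forallP/(_ u)/forallP/(_ v)/eqP := h1.
  by apply/forallP=> u; apply/forallP=> v; rewrite h1.
pose orb F := [exists s, autb s && (flag_act n s F1 == F)].
have orbP F : reflect (same_orbit n a r M F1 F) (orb F).
  apply: (iffP existsP) => [[s /andP[/autP hs /eqP e]]|[s [hs e]]]; first by exists s.
  by exists s; rewrite e eqxx andbT; apply/autP.
have around f v e e' : f \in M -> e \in f -> e' \in f -> v \in e -> v \in e' ->
    same_orbit n a r M (v, e, f) (v, e', f).
  move=> fM ef ef' ve ve'; have [<-|ne] := eqVneq e' e; first exact: same_orbit_refl.
  by apply: c1 => //=; apply/eqP.
have facial f v e w e' : f \in M -> e \in f -> v \in e -> e' \in f -> w \in e' ->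
    same_orbit n a r M (v, e, f) (w, e', f).
  move=> fM ef ve ef' we'.
  apply: (is_cycle_ind (fun u => forall x, x \in f -> u \in x ->
            same_orbit n a r M (v, e, f) (u, x, f)) f v e (cyc f fM) ef ve _ _ w e') => //.
    by move=> x xf vx; apply: around.
  move=> u u' Pu yf x xf ux.
  apply: same_orbit_trans (Pu _ yf (set21 _ _)) _.
  have h : same_orbit n a r M (u', [set u; u'], f) (u', x, f) by apply: around; rewrite ?set22.
  (* The induction along the cycle does not record that the set [[set u; u']] has two elements, so
     the degenerate case is treated apart. *)
  have [uu'|ne] := eqVneq u u'; first by subst u'; apply: around; rewrite ?set21.
  apply: same_orbit_trans h; apply: c0 => //=; first by split; rewrite /= ?set21.
    by split; rewrite /= ?set22.
  by move=> e0; rewrite e0 eqxx in ne.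
pose A := [set f in M | [exists v, exists i, (ed v i \in f) && orb (v, ed v i, f)]].
pose B := M :\: A.
have AP f v e : f \in M -> e \in f -> v \in e -> f \in A <-> same_orbit n a r M F1 (v, e, f).
  move=> fM ef ve; rewrite inE fM /=; split=> [/existsP[w /existsP[i /andP[wf /orbP h]]]|h].
    apply: (same_orbit_trans _ _ _ _ h); apply: facial => //; exact: mem_ed.
  have [i ei] := ed_at _ _ (is_cycle_edge _ _ (cyc f fM) ef) ve.
  by apply/existsP; exists v; apply/existsP; exists i; rewrite -ei ef /=; apply/orbP.
have nonempty f : f \in M -> exists v i, ed v i \in f.
  move=> fM; have /and4P[/set0Pn[e ef] _ _ _] := cyc f fM.
  have /rw_edgeP[v [i ei]] := is_cycle_edge _ _ (cyc f fM) ef.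
  by exists v, i; rewrite -ei.
have split_edge e : rw_edge n a r e -> exists f g, [/\ f \in A, g \in B, e \in f, e \in g &
    forall h, h \in M -> e \in h -> h = f \/ h = g].
  move=> ee; have /rw_edgeP[v [i ei]] := ee; have ve : v \in e by rewrite ei mem_ed.
  have /eqP/cards2P[f [g [fg E]]] := two _ ee.
  have mem h : h \in M -> e \in h -> h = f \/ h = g.
    move=> hM eh; have : h \in [set f; g] by rewrite -E inE hM eh.
    by rewrite in_set2 => /orP[] /eqP->; [left|right].
  have /andP[fM ef] : (f \in M) && (e \in f) by have := set21 f g; rewrite -E inE.
  have /andP[gM eg] : (g \in M) && (e \in g) by have := set22 f g; rewrite -E inE.
  have nfg : ~ same_orbit n a r M (v, e, f) (v, e, g).
    by apply: c2 => //= e0; rewrite e0 eqxx in fg.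
  have [fA|fA] := boolP (f \in A); have [gA|gA] := boolP (g \in A).
  - case: nfg; apply: same_orbit_trans; first by apply: same_orbit_sym; apply/(AP f v e).
    exact/(AP g v e).
  - by exists f, g; split=> //; rewrite inE gA.
  - exists g, f; split=> //; first by rewrite inE fA.
    by move=> h hM eh; case: (mem h hM eh); [right|left].
  (* Both faces lie outside [A]. As there are only two orbits, both flags lie in the orbit of [F2],
     although they differ only in the face. *)
  case: nfg.
  have [/(AP f v e fM ef ve)|h1] := cov (v, e, f) (And3 fM ef ve); first by rewrite (negPf fA).
  have [/(AP g v e gM eg ve)|h2] := cov (v, e, g) (And3 gM eg ve); first by rewrite (negPf gA).
  exact: same_orbit_trans (same_orbit_sym _ _ _ h1) h2.
have AM f : f \in A -> f \in M by rewrite inE => /andP[].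
have BM f : f \in B -> f \in M by rewrite inE => /andP[].
have AB f : f \in A -> f \in B -> False by move=> fA; rewrite inE fA.
have sA s f : map_aut n a r M s -> f \in A -> img_face n s f \in A.
  move=> hs fA; have fM := AM f fA; have [v [i vf]] := nonempty f fM.
  have [sM svf sv] := is_flag_act M s (v, ed v i, f) hs (And3 fM vf (mem_ed v i)).
  apply/(AP _ (s v) (s @: ed v i)) => //.
  apply: same_orbit_trans (_ : same_orbit n a r M (v, ed v i, f) _).
    by apply/(AP f v (ed v i)) => //; apply: mem_ed.
  by exists s.
have sB s f : map_aut n a r M s -> f \in B -> img_face n s f \in B.
  move=> hs fB; have [_ sM] := hs; rewrite inE -{1}sM mem_img_map ?BM // andbT.
  by apply/negP=> /(sA _ _ (map_autV _ _ hs)); rewrite img_faceK => /AB; apply.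
have stable (N : {set {set {set T}}}) :
    (forall s f, map_aut n a r M s -> f \in N -> img_face n s f \in N) ->
    forall s, map_aut n a r M s -> img_map n s N = N.
  move=> sN s hs; apply/setP=> f; apply/imsetP/idP=> [[g gN ->]|fN]; first exact: sN.
  exists (img_face n s^-1 f); last by rewrite img_faceKV.
  by apply: sN => //; apply: map_autV.
exists A, B; split.
- apply/setP=> f; rewrite in_setU; apply/idP/orP=> [fM|[/AM|/BM]//].
  by rewrite [f \in B]inE fM andbT; case: (f \in A); [left|right].
- split=> [f /AM/cyc//|e /split_edge[f [g [fA gB ef eg fgU]]]]; exists f; split=> // h hA eh.
  by case: (fgU h (AM _ hA) eh) => // hg; case: (AB h) => //; rewrite hg.
- split=> [f /BM/cyc//|e /split_edge[f [g [fA gB ef eg fgU]]]]; exists g; split=> // h hB eh.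
  by case: (fgU h (BM _ hB) eh) => // hf; case: (AB h) => //; rewrite hf.
- case: fl1 => fM ef ve eAB; case: (AB F1.2); last rewrite -eAB;
    by apply/(AP _ F1.1.1 F1.1.2) => //; case: (F1) => [[]] *; apply: same_orbit_refl.
split=> [v i w j|s hs]; last by split; apply: stable.
(* Each arc extends to a flag whose face is in [A], and these flags form a single orbit: this yields
   arc-transitivity. *)
have [f [_ [fA _ vf _ _]]] := split_edge _ (rw_edge_ed v i).
have [g [_ [gA _ wg _ _]]] := split_edge _ (rw_edge_ed w j).
have /(AP f v (ed v i) (AM _ fA) vf (mem_ed _ _)) hf := fA.
have /(AP g w (ed w j) (AM _ gA) wg (mem_ed _ _)) hg := gA.
have [s [hs [sv se _]]] := same_orbit_trans _ _ _ _ (same_orbit_sym _ _ _ hf) hg.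
by exists s; split=> //; apply: imset_ed_eq se.
Qed.

Lemma fmap_sub_union tau tau1 tau2 :
  (forall v, tau v != (false, false)) -> separated tau1 -> separated tau2 ->
  (forall f, f \in fmap tau -> f \in fmap tau1 :|: fmap tau2) ->
  forall v, tau v = tau1 v \/ tau v = tau2 v.
Proof.
move=> t0 sep1 sep2 sub v; have fM := face_fmap tau v (false, false).
have := sub _ fM; rewrite in_setU => /orP[] fM'; [left|right].
  exact: fmap_agree (t0 v) sep1 fM fM' (face_refl _ _).
exact: fmap_agree (t0 v) sep2 fM fM' (face_refl _ _).
Qed.

Lemma stable_type L s tau :
  (forall v, tau v != (false, false)) -> separated tau -> affine L s ->
  img_map n s (fmap tau) = fmap tau -> forall v, tau (s v) = shear L (tau v).
Proof.
move=> t0 sep hs st v; pose tau2 u := shear L (tau (s^-1%g u)).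
have e : fmap tau2 = fmap tau.
  by rewrite -st (img_fmap L s tau tau2) // => u; rewrite /tau2 permK.
rewrite -(fmap_inj tau2 tau _ sep e) /tau2 ?permK // => u.
by have := t0 (s^-1%g u); case: (tau _) (L) => [[] []] [].
Qed.

(** * Counting the maps up to isomorphism *)

Section Counting.

Variable v0 : T.
Hypothesis conn : forall P : T -> Prop,
  P v0 -> (forall v i, P v -> P (nb v i)) -> forall v, P v.
Hypothesis arc_trans : forall v i w j,
  exists s, [/\ affine false s, s v = w & s (nb v i) = nb w j].

Lemma shear0 i : shear false i = i.
Proof. by case: i => [[] []]. Qed.

Section Rigid.

Hypothesis const_sep : forall t : dir, t != (false, false) -> separated (fun=> t).
Hypothesis rigid : forall s, graph_aut n a r s -> affine false s.

Definition const_map (t t' : dir) := fmap (fun=> t) :|: fmap (fun=> t').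

Lemma const_map_class (t t' : dir) :
  t != (false, false) -> t' != (false, false) -> t <> t' -> class2_01 n a r (const_map t t').
Proof.
move=> t0 t0' tt'; apply: class2_01_union => //; try exact: const_sep; last first.
  move=> s /rigid hs; exists false; split=> // v; rewrite shear0.
  by move=> e; case: tt'.
move=> v i w j; have [s [hs sv si]] := arc_trans v i w j.
by exists s, false; split=> // u; rewrite shear0.
Qed.

(** When all automorphisms act by translations, each constant pairing is invariant, so isomorphic
    unions use the same two vectors. *)
Lemma const_map_iso t1 t2 t1' t2' :
  t1 != (false, false) -> t2 != (false, false) ->
  t1' != (false, false) -> t2' != (false, false) ->
  map_iso n a r (const_map t1 t2) (const_map t1' t2') ->
  (t1 = t1' \/ t1 = t2') /\ (t2 = t1' \/ t2 = t2').
Proof.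
move=> n1 n2 n1' n2' [s [/rigid hs]].
have fix_const (t : dir) : img_map n s (fmap (fun=> t)) = fmap (fun=> t).
  by apply: (img_fmap false) => // u; rewrite shear0.
rewrite img_mapU !fix_const => E.
split.
  apply: (fmap_sub_union (fun=> t1) (fun=> t1') (fun=> t2') _ _ _ _ v0) => //; try exact: const_sep.
  by move=> f fM; rewrite -/(const_map t1' t2') -E in_setU fM.
apply: (fmap_sub_union (fun=> t2) (fun=> t1') (fun=> t2') _ _ _ _ v0) => //; try exact: const_sep.
by move=> f fM; rewrite -/(const_map t1' t2') -E in_setU fM orbT.
Qed.

(** Both decompositions of a map are stable under a vertex-transitive group acting by translations,
    so their types are constant. What remains is to choose two of the three nonzero vectors. *)
Lemma rigid_count : exactly_k_class2_01_maps n a r 3.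
Proof.
exists [:: const_map (true, false) (false, true); const_map (true, false) (true, true);
          const_map (false, true) (true, true)]; split=> //.
- by move=> M; rewrite !inE => /or3P[] /eqP->; apply: const_map_class.
- by move=> [|[|[|//]]] [|[|[|//]]] //= _ _ /const_map_iso; case=> // -[] //= ? [].
move=> M cM; have [A [B [MAB dA dB AB [tr st]]]] := class2_01_decomposition M cM; subst M.
have [tau t0 eA] := decomposition_fmap A dA; have [tau' t0' eB] := decomposition_fmap B dB.
have inv C (ta : T -> dir) : (forall v, ta v != (false, false)) -> decomposition C -> C = fmap ta ->
    (forall s, map_aut n a r (A :|: B) s -> img_map n s C = C) -> C = fmap (fun=> ta v0).
  move=> n0 dC eC sC; rewrite eC in dC sC *; apply: eq_fmap => v.
  have [s [hs <- _]] := tr v0 (false, false) v (false, false).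
  have sep := decomposition_separated ta n0 dC.
  by rewrite (stable_type false s ta n0 sep (rigid s hs.1) (sC s hs)) shear0.
have eA' := inv A tau t0 dA eA (fun s hs => (st s hs).1).
have eB' := inv B tau' t0' dB eB (fun s hs => (st s hs).2).
have tt : tau v0 <> tau' v0 by move=> e; apply: AB; rewrite eA' eB' e.
rewrite eA' eB' -/(const_map (tau v0) (tau' v0)).
have sym (t t' : dir) : const_map t t' = const_map t' t by rewrite /const_map setUC.
exists (const_map (tau v0) (tau' v0)); last exact: map_iso_refl.
case: (tau v0) (t0 v0) (tau' v0) (t0' v0) tt => [[] []] // _ [[] []] // _ _;
  by rewrite !inE ?eqxx ?orbT // sym eqxx ?orbT.
Qed.

End Rigid.

(** * The case of an extra automorphism exchanging (1,0) and (1,1) *)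

Section Flip.

Variable par : T -> bool.
Hypothesis par_nb : forall v i, par (nb v i) = ~~ par v.
Hypothesis sep_level : separated (fun=> (false, true)).
Hypothesis sep_mixed : forall y, separated (fun v => (true, y && par v)).
Hypothesis aut_affine : forall s, graph_aut n a r s -> exists L, affine L s.
Variables (eps : {perm T}) (i0 : dir).
Hypotheses (eps_affine : affine true eps) (eps_v0 : eps v0 = v0).
Hypothesis eps_nb : eps (nb v0 i0) = nb v0 i0.

Definition mixed (x y : bool) (v : T) : dir := (true, x (+) (y && par v)).

Definition mixed_map y := fmap (fun=> (false, true)) :|: fmap (mixed false y).

(** An automorphism of a connected bipartite graph either preserves the two classes or exchanges
    them. *)
Lemma par_aut s v w : graph_aut n a r s -> par (s v) (+) par v = par (s w) (+) par w.
Proof.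
move=> hs; suff h u : par (s u) (+) par u = par (s v0) (+) par v0 by rewrite !h.
move: u; apply: conn => // u i <-.
have : adj (s u) (s (nb u i)) by rewrite hs adj_nb.
by case/adjP=> j ->; rewrite !par_nb addNb addbN negbK.
Qed.

Lemma par_fix s v w : graph_aut n a r s -> s v = v -> par (s w) = par w.
Proof. by move=> hs sv; have := par_aut s w v hs; rewrite sv addbb; case: (par (s w)) (par w) => [] []. Qed.

Lemma level_shear L : shear L (false, true) = (false, true).
Proof. by case: L. Qed.

Lemma mixed_shear L s x y :
  (forall v, par (s v) = par v) -> forall v, mixed (x (+) L) y (s v) = shear L (mixed x y v).
Proof. by move=> ps v; rewrite /mixed /shear ps /= andbT addbAC. Qed.

(** No automorphism exchanges the two families, because a shear fixes (0,1). For arc-transitivity,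
    an automorphism acting by translations spoils the alternating pairing exactly when it exchanges
    the two vertex classes. It is then corrected by a conjugate of [eps]. *)
Lemma mixed_map_class y : class2_01 n a r (mixed_map y).
Proof.
apply: class2_01_union => //; first exact: sep_mixed.
  move=> v i w j; have [s [hs sv si]] := arc_trans v i w j.
  have [/andP[y1 p1]|yp] := boolP (y && (par (s v) (+) par v)); last first.
    exists s, false; split=> // u; rewrite shear0 // /mixed.
    have := par_aut s v u (affine_aut _ _ hs).
    by case: (y) yp => //= /negPf->; case: (par (s u)) (par u) => [] [].
  have [h [hh hv hi]] := arc_trans v0 i0 w j.
  pose t := (h^-1 * eps * h)%g.
  have at_ : affine true t by apply: affineM (affineM _ _ _ _ (affineV _ _ hh) eps_affine) hh.
  (* The conjugate [t] fixes the target arc, so composing with it does not change the image of the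
     given arc. *)
  have tw : t w = w by rewrite /t !permM -hv permK eps_v0.
  have tj : t (nb w j) = nb w j by rewrite /t !permM -hi permK eps_nb.
  exists (s * t)%g, true; split.
  - exact: affineM hs at_.
  - by rewrite permM sv.
  - by rewrite permM si.
  - by [].
  move=> u; rewrite permM /mixed (par_fix t w) //; last exact: affine_aut at_.
  have := par_aut s v u (affine_aut _ _ hs); rewrite p1 y1 /shear /=.
  by case: (par (s u)) (par u) => [] [].
by move=> s /aut_affine[L hs]; exists L; split=> // v; rewrite level_shear.
Qed.

(** The bit [y] tells whether the types at the two ends of an edge differ. Applying one shear
    everywhere does not alter this. *)
Lemma mixed_map_iso y y' : map_iso n a r (mixed_map y) (mixed_map y') -> y = y'.
Proof.
case=> s [ga E]; have [L hs] := aut_affine s ga.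
pose tau u := shear L (mixed false y (s^-1%g u)).
have ts u : tau (s u) = shear L (mixed false y u) by rewrite /tau permK.
have key u : tau u = mixed false y' u.
  have t0 v : tau v != (false, false) by [].
  have sub f : f \in fmap tau -> f \in mixed_map y'.
    move=> fM; rewrite -E img_mapU in_setU orbC.
    by rewrite (img_fmap L s (mixed false y) tau) // fM.
  by have [|//] := fmap_sub_union tau _ _ t0 sep_level (sep_mixed y') sub u.
have := key (s (nb v0 i0)); have := key (s v0); rewrite !ts.
have : adj (s v0) (s (nb v0 i0)) by rewrite ga adj_nb.
case/adjP=> j ->; rewrite /mixed /shear /= !par_nb.
by case: L y y' (par v0) (par (s v0)) {E hs tau ts key} => [] [] [] [] [].
Qed.

(** On vectors with first coordinate 1 a shear adds a constant to the second coordinate. Its change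
    along an edge is therefore an invariant of the arc, hence the same for all arcs, and
    connectedness determines the type. *)
Lemma mixed_pattern (tau : T -> dir) :
  (forall v, (tau v).1) ->
  (forall v i w j, exists s L,
     [/\ s v = w, s (nb v i) = nb w j & forall u, tau (s u) = shear L (tau u)]) ->
  exists x y, forall v, tau v = mixed x y v.
Proof.
move=> t1 tr; pose c v := (tau v).2.
have tc v : tau v = (true, c v) by have := t1 v; rewrite /c; case: (tau v) => [[] ?].
have cc v i : c (nb v i) (+) c v = c (nb v0 i0) (+) c v0.
  have [s [L [sv si h]]] := tr v0 i0 v i.
  have := h v0; have := h (nb v0 i0); rewrite sv si !tc => -[->] [->].
  by case: (c _) (c _) (L) => [] [] [].
pose y := c (nb v0 i0) (+) c v0; exists (c v0 (+) (y && par v0)), y.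
apply: conn => [|v i]; first by rewrite tc /mixed -addbA addbb addbF.
rewrite !tc => -[e]; rewrite /mixed par_nb; congr (_, _).
have := cc v i; rewrite -/y e; case: (c (nb v i)) (c v0) (y) (par v0) (par v) => [] [] [] [] [] //.
Qed.

(** Shears preserve the first coordinate, so each family is either the level pairing or mixed. If
    one of them is mixed, [eps] normalises it to [x = false]. The real point is to exclude two mixed
    families. *)
Lemma flip_count : exactly_k_class2_01_maps n a r 2.
Proof.
exists [:: mixed_map false; mixed_map true]; split=> //.
- by move=> M; rewrite !inE => /orP[] /eqP->; apply: mixed_map_class.
- by move=> [|[|//]] [|[|//]] //= _ _ /mixed_map_iso.
move=> M cM; have [A [B [MAB dA dB AB [tr st]]]] := class2_01_decomposition M cM.
have [tau t0 eA] := decomposition_fmap A dA; have [tau' t0' eB] := decomposition_fmap B dB.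
have sA : separated tau by apply: decomposition_separated => //; rewrite -eA.
have sB : separated tau' by apply: decomposition_separated => //; rewrite -eB.
have tr2 v i w j : exists s L, [/\ s v = w, s (nb v i) = nb w j,
    forall u, tau (s u) = shear L (tau u) & forall u, tau' (s u) = shear L (tau' u)].
  have [s [hs sv si]] := tr v i w j; have [L aL] := aut_affine s hs.1.
  have [h1 h2] := st s hs; rewrite eA in h1; rewrite eB in h2.
  by exists s, L; split=> //; apply: stable_type.
have cases (ta : T -> dir) : (forall v, ta v != (false, false)) ->
    (forall v i w j, exists s L,
      [/\ s v = w, s (nb v i) = nb w j & forall u, ta (s u) = shear L (ta u)]) ->
    (forall v, ta v = (false, true)) \/ exists x y, forall v, ta v = mixed x y v.
  move=> n0 trt.
  have c1 v : (ta v).1 = (ta v0).1.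
    by have [s [L [<- _ ->]]] := trt v0 i0 v i0.
  case E: (ta v0).1; [right|left].
    by apply: mixed_pattern => // v; rewrite c1.
  by move=> v; have := n0 v; have := c1 v; rewrite E; case: (ta v) => [[] []].
have iso_mixed x y : exists2 M', M' \in [:: mixed_map false; mixed_map true] &
    map_iso n a r (fmap (fun=> (false, true)) :|: fmap (mixed x y)) M'.
  exists (mixed_map y); first by case: y; rewrite !inE eqxx ?orbT.
  case: x; last exact: map_iso_refl.
  exists eps; split; first exact: affine_aut eps_affine.
  rewrite img_mapU (img_fmap true eps (fun=> (false, true)) (fun=> (false, true))) //.
  rewrite (img_fmap true eps (mixed true y) (mixed false y)) // => v.
  by rewrite -(mixed_shear true eps) // => u; apply: par_fix eps_v0; apply: affine_aut eps_affine.
have [cA|[x [y cA]]] := cases tau t0 (fun v i w j => let: ex_intro s (ex_intro L (And4 h1 h2 h3 _)) := tr2 v i w j in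
    ex_intro _ s (ex_intro _ L (And3 h1 h2 h3)));
have [cB|[x' [y' cB]]] := cases tau' t0' (fun v i w j => let: ex_intro s (ex_intro L (And4 h1 h2 _ h3)) := tr2 v i w j in
    ex_intro _ s (ex_intro _ L (And3 h1 h2 h3))).
- by case: AB; rewrite eA eB; apply: eq_fmap => v; rewrite cA cB.
- by rewrite MAB eA eB (eq_fmap _ _ cA) (eq_fmap _ _ cB).
- by rewrite MAB eA eB (eq_fmap _ _ cA) (eq_fmap _ _ cB) setUC.
have diff v : tau v <> tau' v.
  move=> e; case: AB; rewrite eA eB; apply: eq_fmap => w.
  by have [s [L [<- _ -> ->]]] := tr2 v i0 w i0; rewrite e.
have pe u : par (eps u) = par u by apply: par_fix eps_v0; apply: affine_aut eps_affine.
(* Two mixed types that differ at every vertex differ by (0,1) everywhere, which is the effect of a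
   shear. So [eps] exchanges the two families and preserves the map, against the stability of
   [A]. *)
have swap v : tau' (eps v) = shear true (tau v).
  rewrite cA -(mixed_shear true eps) //.
  have := diff (eps v); rewrite cA !cB /mixed addbT.
  by case: (x) (x') (y && _) (y' && _) => [] [] [] [].
have swap' v : tau (eps v) = shear true (tau' v).
  rewrite cB -(mixed_shear true eps) //.
  have := diff (eps v); rewrite !cA cB /mixed addbT.
  by case: (x) (x') (y && _) (y' && _) => [] [] [] [].
have eM : map_aut n a r M eps.
  split; first exact: affine_aut eps_affine.
  by rewrite MAB eA eB img_mapU (img_fmap true eps tau tau') // (img_fmap true eps tau' tau) // setUC.
case: AB; rewrite -(st eps eM).1 eA (img_fmap true eps tau tau') //.
Qed.

End Flip.

End Counting.

End PairingMaps.

(** * Coordinates on the Rose Window graph *)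

Local Arguments Z.mul : simpl never.
Local Arguments Z.add : simpl never.
Local Arguments Z.sub : simpl never.
Local Arguments Z.modulo : simpl never.
Local Arguments Z.div : simpl never.
Local Arguments Z.of_nat : simpl never.
Local Arguments Z.to_nat : simpl never.

(* With q = 3d, so that 4q = 0 modulo n, the triples (false, k, t) and (true, k, t)
   stand for the vertices x_{k + qt} and y_{k - 1 + qt} of level k. *)
Definition coord := (bool * Z * Z)%type.

(** The labels are chosen so that [translate], [reflect_level] and [exchange] act on directions by
    translations, and [twist] with the shear as its linear part. *)
Definition nbc (c : coord) (i : dir) : coord :=
  let: (b, k, t) := c in
  match b, i with
  | false, (false, false) => (false, k + 1, t)
  | false, (false, true) => (true, k + 1, t)
  | false, (true, false) => (false, k - 1, t)
  | false, (true, true) => (true, k - 1, t - 1)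
  | true, (false, false) => (true, k + 1, t - 1)
  | true, (false, true) => (false, k + 1, t + 1)
  | true, (true, false) => (false, k - 1, t)
  | true, (true, true) => (true, k - 1, t + 1)
  end%Z.

Definition dirs : seq dir := [:: (false, false); (false, true); (true, false); (true, true)].

Lemma all_dirs (P : pred dir) : all P dirs -> forall i, P i.
Proof. by move=> /and5P[? ? ? ? _] [[] []]. Qed.

Definition eqc (c c' : coord) : bool :=
  let: (b, k, t) := c in let: (b', k', t') := c' in
  [&& b == b', Z.eqb k k' & Z.eqb ((t - t') mod 4) 0].

(** Levels live modulo 3m. Working modulo 3 gives a test of difference that is valid for every m, so
    that one computation serves all graphs. *)
Definition distinct_level (c c' : coord) : bool := negb (Z.eqb ((c.1.2 - c'.1.2) mod 3) 0).

(** The graph has no 4-cycle. The end levels lie in {-2, 0, 2}, so they are equal or differ modulo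
    3, and [eqc] then decides equality of the end vertices for every m. *)
Lemma no_square b i j i' j' :
  let p := nbc (b, 0%Z, 0%Z) i in let q := nbc (b, 0%Z, 0%Z) j in
  let x := nbc p i' in let y := nbc q j' in
  (distinct_level x y || Z.eqb x.1.2 y.1.2) && (eqc x y ==> (eqc p q || eqc x (b, 0%Z, 0%Z))).
Proof. by case: b i j i' j' => [] [[] []] [[] []] [[] []] [[] []]; vm_compute. Qed.

Lemma div3P k : exists j, (k = 3 * j + 0 \/ k = 3 * j + 1 \/ k = 3 * j + 2)%Z.
Proof.
exists (k / 3)%Z; have := Z.div_mod k 3; have := Z.mod_pos_bound k 3.
by move: (k / 3)%Z (k mod 3)%Z => q s; lia.
Qed.

Lemma div3E j c : (0 <= c < 3)%Z -> ((3 * j + c) / 3 = j)%Z.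
Proof. by move=> hc; apply/esym; apply: (Z.div_unique_pos _ _ _ c). Qed.

Lemma mod3E j c : (0 <= c < 3)%Z -> ((3 * j + c) mod 3 = c)%Z.
Proof. by move=> hc; apply/esym; apply: (Z.mod_unique_pos _ _ j). Qed.

Ltac reduce3 j :=
  repeat match goal with
  | |- context [(?x mod 3)%Z] =>
    first [ replace x with (3 * j + 0)%Z by lia | replace x with (3 * j + 1)%Z by lia
          | replace x with (3 * j + 2)%Z by lia | replace x with (3 * (j + 1) + 0)%Z by lia
          | replace x with (3 * (j - 1) + 2)%Z by lia ];
    rewrite ?(mod3E, div3E) //
  end.

(** This map and the next two generate an arc-transitive group. [reflect_level] and [exchange] fix
    x_0 and act on its neighbours as the translations by (1,0) and (0,1); [exchange] also mixes the
    x and y vertices. *)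
Definition translate (z : Z) (c : coord) : coord := let: (b, k, t) := c in (b, k + z, t)%Z.

Definition reflect_level (c : coord) : coord :=
  let: (b, k, t) := c in (b, - k, - t - Z.b2z b)%Z.

Definition exchange (c : coord) : coord :=
  let: (b, k, t) := c in
  match b, (k mod 3)%Z with
  | false, 0 => (false, k, t)
  | false, 1 => (true, k, t)
  | false, _ => (true, k, t - 1)
  | true, 0 => (true, k, t + 2)
  | true, 1 => (false, k, t)
  | true, _ => (false, k, t + 1)
  end%Z.

(** Locally this is always a symmetry ([twist_nbc]). Raising the level by 3d amounts to raising t by
    1, while the formula adds d to the new t. The two readings agree only if d + 2 is a multiple of
    4, that is, if m = 2 modulo 4. *)
Definition twist (c : coord) : coord :=
  let: (b, k, t) := c in
  match b, (k mod 3)%Z with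
  | false, 0 => (false, k, k / 3 - t)
  | false, 1 => (false, k, k / 3 - t)
  | false, _ => (true, k, k / 3 - t)
  | true, 0 => (true, k, k / 3 + 2 - t)
  | true, 1 => (true, k, k / 3 - t)
  | true, _ => (false, k, k / 3 - t)
  end%Z.

Definition rev_dir (b : bool) (i : dir) : dir :=
  match b, i with
  | false, (false, _) => (true, false)
  | false, (true, false) => (false, false)
  | false, (true, true) => (false, true)
  | true, (false, _) => (true, true)
  | true, (true, false) => (false, true)
  | true, (true, true) => (false, false)
  end.

(** The hypotheses of [coloring_separated] when pairing and colour depend only on the kind of
    vertex, the level modulo N and the direction. All ranges are finite, so the check is a
    computation. *)
Definition residue_coloring (N : nat) (tau : Z -> dir) (col : bool -> Z -> dir -> nat) : bool :=
  all (fun b => all (fun x => let k := Z.of_nat x in all (fun i =>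
    [&& col b k (dadd i (tau k)) == col b k i,
        all (fun j => (col b k i == col b k j) ==> (j == i) || (j == dadd i (tau k))) dirs &
        let: (b', k', _) := nbc (b, k, 0%Z) i in
        col b' (k' mod Z.of_nat N)%Z (rev_dir b i) == col b k i])
    dirs) (iota 0 N)) [:: false; true].

(** Faces of the pairing (0,1) stay between two consecutive levels; the colour is the lower of the
    two. *)
Definition color_level (b : bool) (k : Z) (i : dir) : nat :=
  Z.to_nat ((if i.1 then k - 1 else k) mod 3)%Z.

(* The colour 3 is that of the cycle x_0 x_1 x_2 ..., resp. (for color_hub) of
   the cycles formed by the edges y_i y_{i+r}. *)
Definition color_rim (b : bool) (k : Z) (i : dir) : nat :=
  match b, i.2 with
  | false, false => 3
  | false, true => Z.to_nat (k mod 3)%Z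
  | true, false => Z.to_nat ((k - 1) mod 3)%Z
  | true, true => Z.to_nat ((k + 1) mod 3)%Z
  end.

Definition color_hub (b : bool) (k : Z) (i : dir) : nat :=
  match b, i.1 (+) i.2 with
  | false, false => Z.to_nat (k mod 3)%Z
  | false, true => Z.to_nat ((k - 1) mod 3)%Z
  | true, false => 3
  | true, true => Z.to_nat ((k + 1) mod 3)%Z
  end.

(* The colour 6 is that of the cycles consisting of edges x_i y_i and y_i x_{i+a} only. *)
Definition color_mixed (b : bool) (k : Z) (i : dir) : nat :=
  match b, Z.odd k, i.2, i.1 (+) i.2 with
  | false, false, false, _ => Z.to_nat (k mod 6)%Z
  | false, false, true, _ => 6
  | false, true, _, false => Z.to_nat ((k + 1) mod 6)%Z
  | false, true, _, true => Z.to_nat ((k - 1) mod 6)%Z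
  | true, false, false, _ => Z.to_nat ((k - 2) mod 6)%Z
  | true, false, true, _ => Z.to_nat ((k + 2) mod 6)%Z
  | true, true, _, false => Z.to_nat ((k - 3) mod 6)%Z
  | true, true, _, true => 6
  end.

Lemma color_levelP : residue_coloring 3 (fun=> (false, true)) color_level.
Proof. by vm_compute. Qed.

Lemma color_rimP : residue_coloring 3 (fun=> (true, false)) color_rim.
Proof. by vm_compute. Qed.

Lemma color_hubP : residue_coloring 3 (fun=> (true, true)) color_hub.
Proof. by vm_compute. Qed.

Lemma color_mixedP : residue_coloring 6 (fun k => (true, Z.odd k)) color_mixed.
Proof. by vm_compute. Qed.

(** The equality test is a parameter, so that equality of vertices can be replaced by a computable
    test: [eqc] for large m, [eq_mod] with numerals for small m. *)
Fixpoint walks_coord (eqt : rel coord) (l : nat) (c c' : coord) : nat :=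
  if l is l'.+1 then sumn [seq walks_coord eqt l' (nbc c i) c' | i <- dirs] else eqt c c'.

Definition eq_mod (M D : Z) (c c' : coord) : bool :=
  let: (b, k, t) := c in let: (b', k', t') := c' in
  (b == b') && Z.eqb ((k - Z.b2z b + 3 * D * t - (k' - Z.b2z b' + 3 * D * t')) mod (12 * M)) 0.

(** * The graphs of the family, in coordinates *)

Section Family.

Variables m d : nat.
Hypothesis m_gt0 : 0 < m.
Hypothesis dE : d = m \/ d = 11 * m.

Local Notation n := (12 * m).
Local Notation a := ((3 * d + 2) %% (12 * m)).
Local Notation r := ((9 * d + 1) %% (12 * m)).
Local Notation T := (rw_vert (12 * m)).
Local Notation mZ := (Z.of_nat m).
Local Notation dZ := (Z.of_nat d).

Lemma vx_subproof (z : Z) : Z.to_nat (z mod (12 * mZ)) < 12 * m.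
Proof. have := Z.mod_pos_bound z (12 * mZ); lia. Qed.

Definition vx (b : bool) (z : Z) : T := (b, Ordinal (vx_subproof z)).

Definition pt (c : coord) : T :=
  let: (b, k, t) := c in vx b (k - Z.b2z b + 3 * dZ * t).

Lemma vx_eqP b z (v : T) :
  v = vx b z <-> v.1 = b /\ exists w, Z.of_nat v.2 = (z + 12 * mZ * w)%Z.
Proof.
have N0 : (12 * mZ <> 0)%Z by lia.
have dm := Z.div_mod z (12 * mZ) N0; have bd := Z.mod_pos_bound z (12 * mZ).
split=> [->|[vb [w hw]]].
  split=> //; exists (- (z / (12 * mZ)))%Z; rewrite /=.
  by move: (z mod _)%Z (z / _)%Z dm bd => q s; lia.
case: v vb hw => [b' j] /= -> hw; congr pair; apply: val_inj => /=.
have := ltn_ord j; have := Z.mod_unique_pos z (12 * mZ) (- w) (Z.of_nat j).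
move: (z mod _)%Z => s h lt; rewrite -h; lia.
Qed.

Lemma vx_eq b z b' z' :
  vx b z = vx b' z' <-> b = b' /\ exists w, z = (z' + 12 * mZ * w)%Z.
Proof.
have [_ [u hu]] := (vx_eqP b z (vx b z)).1 erefl; rewrite (vx_eqP b' z') hu.
split=> -[e [w hw]]; split=> //; first by exists (w - u)%Z; lia.
by exists (w + u)%Z; lia.
Qed.

Lemma d_multiple : exists e, dZ = (e * mZ)%Z /\ (e = 1 \/ e = 11)%Z.
Proof. by case: dE => ->; [exists 1%Z|exists 11%Z]; split; lia. Qed.

Lemma pt_eq b k t t' : (exists u, t = t' + 4 * u)%Z -> pt (b, k, t) = pt (b, k, t').
Proof.
case=> u ->; apply/vx_eq; split=> //; have [e [-> _]] := d_multiple.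
by exists (e * u)%Z; lia.
Qed.

(** The level of a vertex is determined modulo 3m and, once the level is fixed as an integer, t is
    determined modulo 4. *)
Lemma pt_inv b k t b' k' t' : pt (b, k, t) = pt (b', k', t') ->
  [/\ b = b', exists w, (k - k' = 3 * mZ * w)%Z & k = k' -> exists u, (t = t' + 4 * u)%Z].
Proof.
move/vx_eq=> [-> [w hw]]; have [e [de he]] := d_multiple; rewrite de in hw; split=> //.
  exists (4 * w - e * (t - t'))%Z; lia.
move=> kk'.
have h : (mZ * (4 * w - e * (t - t')) = 0)%Z by lia.
have {}h : (4 * w - e * (t - t') = 0)%Z by move/Z.mul_eq_0: h => []; lia.
(* For e = 11 the relation 4w = 11(t - t') is solved by writing 11 = 12 - 1. *)
by case: he => ee; subst e; [exists w|exists (3 * (t - t') - w)%Z]; lia.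
Qed.

Definition crd (v : T) : coord := (v.1, Z.of_nat v.2 + Z.b2z v.1, 0)%Z.

Lemma crdK v : pt (crd v) = v.
Proof. apply/esym/vx_eqP; split=> //; exists 0%Z; lia. Qed.

Definition nb (v : T) (i : dir) : T := pt (nbc (crd v) i).

Lemma nb_pt c i : nb (pt c) i = pt (nbc c i).
Proof.
rewrite /nb; move: (crd (pt c)) (crdK (pt c)) => c0; case: c0 c => [[b k] t] [[b' k'] t'].
move/vx_eq=> [-> [w hw]]; case: b' hw i => hw [[] []]; apply/vx_eq; split=> //;
  by exists w; move: hw => /=; lia.
Qed.

Lemma eq_modnP (j : 'I_n) x :
  (nat_of_ord j == x %% n) <-> exists w, Z.of_nat j = (Z.of_nat x + 12 * mZ * w)%Z.
Proof.
have e := divn_eq x n; have lt : x %% n < n by rewrite ltn_mod; lia.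
have := ltn_ord j; move: (x %/ n) (x %% n) e lt => q s e lt ltj; split=> [/eqP ->|[w hw]].
  by exists (- Z.of_nat q)%Z; lia.
suff : w = (- Z.of_nat q)%Z by move=> ew; apply/eqP; subst w; lia.
nia.
Qed.

Lemma modnZ x : exists w, Z.of_nat (x %% n) = (Z.of_nat x + 12 * mZ * w)%Z.
Proof. by exists (- Z.of_nat (x %/ n))%Z; have := divn_eq x n; lia. Qed.

Lemma rw_adjE u v : rw_adj n a r u v = [exists i, v == nb u i].
Proof.
have [e [de he]] := d_multiple.
have [wr hr] := modnZ (9 * d + 1); have [wa ha] := modnZ (3 * d + 2).
have lta : a < n by rewrite ltn_mod; lia.
case: u v => [b i] [b' j]; rewrite /rw_adj /=.
apply/idP/existsP => [|[k /eqP E]].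
  case: b b' => [] [] /orP[] => [/eq_modnP|/eq_modnP|/eqP|/eq_modnP|/eqP|/eq_modnP|/eq_modnP|/eq_modnP].
  (* A hub edge adds r = 9d + 1 to the index, whereas [nbc] adds 1 - 3d. The difference 12d = 12me
     accounts for the term [e]. *)
  - case=> w hw; exists (false, false); apply/eqP/vx_eqP; split=> //=.
    by exists (w + wr + e)%Z; lia.
  - case=> w hw; exists (true, true); apply/eqP/vx_eqP; split=> //=.
    by exists (- w - wr - e)%Z; lia.
  - move=> ij; exists (true, false); apply/eqP/vx_eqP; split=> //=.
    by exists 0%Z; lia.
  - case=> w hw; exists (false, true); apply/eqP/vx_eqP; split=> //=.
    by exists (- 1 - w + wa)%Z; lia.
  - move=> ij; exists (false, true); apply/eqP/vx_eqP; split=> //=.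
    by exists 0%Z; lia.
  - case=> w hw; exists (true, true); apply/eqP/vx_eqP; split=> //=.
    by exists (1 + w - wa)%Z; lia.
  - case=> w hw; exists (false, false); apply/eqP/vx_eqP; split=> //=.
    by exists w%Z; lia.
  - case=> w hw; exists (true, false); apply/eqP/vx_eqP; split=> //=.
    by exists (- w)%Z; lia.
have same (x y : 'I_n) w : Z.of_nat x = (Z.of_nat y + 12 * mZ * w)%Z -> nat_of_ord x == y.
  have := ltn_ord x; have := ltn_ord y; move: (nat_of_ord x) (nat_of_ord y) => p q h1 h2 h3.
  apply/eqP; have [w0|[w0|w0]] : (w = 0 \/ 1 <= w \/ w <= -1)%Z by lia.
  - by subst w; lia.
  - have : (mZ * 1 <= mZ * w)%Z by apply: Z.mul_le_mono_nonneg_l; lia.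
    by lia.
  have : (mZ * w <= mZ * -1)%Z by apply: Z.mul_le_mono_nonneg_l; lia.
  by lia.
case: b b' k E => [] [] [[] []] /vx_eqP[//= _ [w hw]]; apply/orP.
- by right; apply/eq_modnP; exists (- w - wr - e)%Z; move: hw => /=; lia.
- by left; apply/eq_modnP; exists (w - wr - e)%Z; move: hw => /=; lia.
- by left; apply: (same _ _ (- w)%Z); move: hw => /=; lia.
- by right; apply/eq_modnP; exists (wa - 1 - w)%Z; move: hw => /=; lia.
- by right; apply/eq_modnP; exists (w - 1 + wa)%Z; move: hw => /=; lia.
- by left; apply: (same _ _ w); move: hw => /=; lia.
- by right; apply/eq_modnP; exists (- w)%Z; move: hw => /=; lia.
- by left; apply/eq_modnP; exists w; move: hw => /=; lia.
Qed.

Lemma nb_inj v : injective (nb v).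
Proof.
move=> i j; rewrite -(crdK v) !nb_pt; case: (crd v) => [[b k] t].
by case: b i j => [] [[] []] [[] []] //= /pt_inv[] // _ [w hw] h;
  first [exfalso; lia | have [u hu] := h ltac:(lia); exfalso; lia].
Qed.

Lemma nb_neq v i : nb v i != v.
Proof.
apply/eqP; rewrite -(crdK v) nb_pt; case: (crd v) => [[b k] t].
by case: b i => [] [[] []] //= /pt_inv[] // _ [w hw] h; exfalso; lia.
Qed.

Definition base (k0 : Z) (c : coord) : T := pt (c.1.1, k0 + c.1.2, c.2)%Z.

Definition level (v : T) : Z := (Z.of_nat v.2 + Z.b2z v.1)%Z.

Lemma nb_base k0 c i : nb (base k0 c) i = base k0 (nbc c i).
Proof.
case: c => [[b k] t]; rewrite /base nb_pt /=.
by case: b i => [] [[] []]; apply/vx_eq; split=> //=; exists 0%Z; lia.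
Qed.

Lemma baseK v : base (level v) (v.1, 0, 0)%Z = v.
Proof. by rewrite /base /= Z.add_0_r; exact: crdK. Qed.

Lemma eqc_base k0 c c' : eqc c c' -> base k0 c = base k0 c'.
Proof.
case: c c' => [[b k] t] [[b' k'] t'] /and3P[/eqP-> /Z.eqb_eq-> /Z.eqb_eq h].
have [q hq] : (4 | t - t')%Z by apply/Z.mod_divide.
by apply: pt_eq; exists q => /=; lia.
Qed.

Lemma base_eqc k0 c c' :
  distinct_level c c' || Z.eqb c.1.2 c'.1.2 -> base k0 c = base k0 c' -> eqc c c'.
Proof.
case: c c' => [[b k] t] [[b' k'] t']; rewrite /distinct_level /base /= => far.
move/pt_inv=> [-> [w hw] h]; rewrite eqxx /=.
have kk : k = k'.
  have [/negP far'|/Z.eqb_eq kk'] := orP far; last exact: kk'.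
  case: far'; apply/Z.eqb_eq; have -> : (k - k' = mZ * w * 3)%Z by lia.
  exact: Z_mod_mult.
subst k'; rewrite Z.eqb_refl /=; have [//|u ->] := h; apply/Z.eqb_eq.
have -> : (t' + 4 * u - t' = u * 4)%Z by lia.
exact: Z_mod_mult.
Qed.

Lemma common_nb u w i j i' j' :
  nb (nb u i) i' = w -> nb (nb u j) j' = w -> w <> u -> nb u i = nb u j.
Proof.
rewrite -(baseK u) !nb_base => e1 e2 wu.
have /andP[far /implyP h] := no_square u.1 i j i' j'.
have e := base_eqc _ _ _ far (etrans e1 (esym e2)).
have /orP[/eqc_base//|/eqc_base h'] := h e.
by case: wu; rewrite -e1 h'.
Qed.

(** * Explicit automorphisms and arc-transitivity *)

Definition compatible (f : coord -> coord) : Prop :=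
  forall c c', pt c = pt c' -> pt (f c) = pt (f c').

Lemma coord_symmetry f g L :
  compatible f -> compatible g -> (forall c, pt (g (f c)) = pt c) ->
  (forall c, exists k, forall i, pt (f (nbc c i)) = pt (nbc (f c) (dadd k (shear L i)))) ->
  exists s : {perm T}, affine n nb L s /\ forall c, s (pt c) = pt (f c).
Proof.
move=> cf cg fK hf; pose F v := pt (f (crd v)); pose G v := pt (g (crd v)).
have Fpt c : F (pt c) = pt (f c) by apply: cf; rewrite crdK.
have Gpt c : G (pt c) = pt (g c) by apply: cg; rewrite crdK.
have FK : cancel F G by move=> v; rewrite -(crdK v) Fpt Gpt fK.
exists (perm (can_inj FK)); split=> [v|c]; last by rewrite permE Fpt.
have [k hk] := hf (crd v); exists k => i; rewrite !permE -{1 2}(crdK v) nb_pt !Fpt nb_pt.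
exact: hk.
Qed.

Lemma pt_eq3 b b' k k' t t' : b = b' -> k = k' -> (exists u, t = t' + 4 * u)%Z ->
  pt (b, k, t) = pt (b', k', t').
Proof. by move=> -> ->; apply: pt_eq. Qed.

Ltac pt_crush := apply: pt_eq3; [by []|lia|
  first [exists 0%Z; lia | exists 1%Z; lia | exists (- 1)%Z; lia | exists (- 2)%Z; lia]].

Ltac find_shift tac := first
  [ exists (false, false); solve [tac] | exists (false, true); solve [tac]
  | exists (true, false); solve [tac] | exists (true, true); solve [tac] ].

Lemma translate_sym z : exists s : {perm T}, affine n nb false s /\ forall c, s (pt c) = pt (translate z c).
Proof.
have ct y : compatible (translate y).
  move=> [[b k] t] [[b' k'] t'] /vx_eq[-> [w hw]]; apply/vx_eq; split=> //.
  by exists w; lia.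
apply: (coord_symmetry _ (translate (- z))) => //.
  by move=> [[b k] t]; pt_crush.
by move=> [[b k] t]; exists (false, false); case: b => -[[] []] /=; pt_crush.
Qed.

Lemma reflect_sym : exists s : {perm T}, affine n nb false s /\ forall c, s (pt c) = pt (reflect_level c).
Proof.
have ct : compatible reflect_level.
  move=> [[b k] t] [[b' k'] t'] /vx_eq[-> [w hw]]; apply/vx_eq; split=> //.
  by exists (- w)%Z; lia.
apply: (coord_symmetry _ reflect_level) => //.
  by move=> [[b k] t]; pt_crush.
move=> [[[] k] t]; [exists (true, true)|exists (true, false)]; move=> [[] []] /=; pt_crush.
Qed.

Lemma exchange_sym : exists s : {perm T}, affine n nb false s /\ forall c, s (pt c) = pt (exchange c).
Proof.
have ct : compatible exchange.
  move=> [[b k] t] [[b' k'] t'] e; have [bb [w' hw'] _] := pt_inv _ _ _ _ _ _ e; subst b'.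
  move/vx_eq: e => [_ [w hw]].
  have hm : (k mod 3 = k' mod 3)%Z.
    rewrite (_ : k = k' + mZ * w' * 3)%Z; last by lia.
    exact: Z_mod_plus_full.
  rewrite /exchange hm; have [j [hj|[hj|hj]]] := div3P k'; rewrite hj in hw *; reduce3 j;
    by case: b hw => hw; apply/vx_eq; split=> //; exists w; move: hw => /=; lia.
apply: (coord_symmetry _ exchange) => //.
  by move=> [[b k] t]; have [j [->|[->|->]]] := div3P k; case: b; rewrite /exchange; reduce3 j; pt_crush.
move=> [[b k] t]; have [j [->|[->|->]]] := div3P k; case: b;
  find_shift ltac:(move=> [[] []]; rewrite /= /exchange; reduce3 j; pt_crush).
Qed.

Lemma twist_nbc c :
  exists k, forall i, pt (twist (nbc c i)) = pt (nbc (twist c) (dadd k (shear true i))).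
Proof.
case: c => [[b k] t]; have [j [->|[->|->]]] := div3P k; case: b;
  find_shift ltac:(move=> [[] []]; rewrite /= /twist; reduce3 j; pt_crush).
Qed.

Lemma twist_sym : m %% 4 = 2 ->
  exists s : {perm T}, affine n nb true s /\ forall c, s (pt c) = pt (twist c).
Proof.
move=> m4; have [e [de he]] := d_multiple.
have [g hg] : exists g, (dZ + 2 = 4 * g)%Z.
  have := divn_eq m 4; rewrite m4; case: he => ee; subst e => hm.
    by exists (Z.of_nat (m %/ 4) + 1)%Z; lia.
  by exists (11 * Z.of_nat (m %/ 4) + 6)%Z; lia.
have ct : compatible twist.
  move=> [[b k] t] [[b' k'] t'] E; have [bb [w' hw'] _] := pt_inv _ _ _ _ _ _ E; subst b'.
  move/vx_eq: E => [_ [w hw]].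
  have [j' hj] := div3P k'; pose j := (j' + mZ * w')%Z.
  have jj : (3 * (j - j') = - (3 * dZ * (t - t')) + 12 * mZ * w)%Z by rewrite /j; lia.
  have w'E : ((j - j') = 4 * (mZ * w) - dZ * (t - t'))%Z by lia.
  have key c s : (0 <= c < 3)%Z -> k' = (3 * j' + c)%Z -> k = (3 * j + c)%Z ->
      forall b', pt (b', 3 * j + c, j + s - t)%Z = pt (b', 3 * j' + c, j' + s - t')%Z.
    (* The difference of the two twisted indices is 3(j - j')(1 + d) - 3d(t - t'). Substituting 3(j
       - j') = 12mw - 3d(t - t') leaves 12mw(1 + d) - 3d(d + 2)(t - t'), and 3d(d + 2) = 12meg. *)
    move=> hc k1 k2 b'; apply/vx_eq; split=> //; exists (w * (1 + dZ) - e * g * (t - t'))%Z.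
    have e1 : (3 * (j - j') * (1 + dZ) = (12 * (mZ * w) - 3 * dZ * (t - t')) * (1 + dZ))%Z.
      by rewrite (_ : 3 * (j - j') = 12 * (mZ * w) - 3 * dZ * (t - t'))%Z //; lia.
    have e2 : (12 * mZ * (e * g * (t - t')) = 3 * dZ * (dZ + 2) * (t - t'))%Z.
      by rewrite hg de; lia.
    by move: (Z.b2z b') => bb; lia.
  have keyk c : k' = (3 * j' + c)%Z -> k = (3 * j + c)%Z by rewrite /j; lia.
  have split0 x y : (x - y = x + 0 - y)%Z by lia.
  case: hj => [|[|]] hj; have := keyk _ hj => hk; rewrite hj hk /twist;
  rewrite ?(mod3E, div3E) //;
  by case: b {hw}; rewrite ?[(j - t)%Z]split0 ?[(j' - t')%Z]split0; apply: key.
apply: (coord_symmetry _ twist) => //; last exact: twist_nbc.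
by move=> [[b k] t]; have [j [->|[->|->]]] := div3P k; case: b; rewrite /twist; reduce3 j; pt_crush.
Qed.

Definition origin : T := pt (false, 0, 0)%Z.

Lemma arc_trans v i w j :
  exists s : {perm T}, [/\ affine n nb false s, s v = w & s (nb v i) = nb w j].
Proof.
suff to_origin u k : exists s : {perm T},
    [/\ affine n nb false s, s u = origin & s (nb u k) = nb origin (false, false)].
  have [s [hs sv si]] := to_origin v i; have [t [ht tw tj]] := to_origin w j.
  exists (s * t^-1)%g; split; first exact: affineM hs (affineV _ _ _ _ ht).
    by rewrite permM sv -tw permK.
  by rewrite permM si -tj permK.
have [mu [hmu muE]] := reflect_sym; have [de [hde deE]] := exchange_sym.
have at_origin l : exists s : {perm T},
    [/\ affine n nb false s, s origin = origin & s (nb origin l) = nb origin (false, false)].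
  have mu0 : mu origin = origin by rewrite muE; pt_crush.
  have de0 : de origin = origin by rewrite deE; pt_crush.
  have one : affine n nb false (1 : {perm T})%g.
    by move=> x; exists (false, false) => -[[] []]; rewrite !perm1.
  case: l => [[] []].
  - exists (mu * de)%g; split; first exact: affineM hmu hde.
      by rewrite permM mu0 de0.
    by rewrite permM !nb_pt muE deE; pt_crush.
  - exists mu; split=> //.
    by rewrite !nb_pt muE; pt_crush.
  - exists de; split=> //.
    by rewrite !nb_pt deE; pt_crush.
  by exists 1%g; split=> //; rewrite perm1.
suff [s [hs su]] : exists s : {perm T}, affine n nb false s /\ s u = origin.
  have [l hl] := hs u; have [t [ht t0 tl]] := at_origin (dadd l (shear false k)).
  exists (s * t)%g; split; first exact: affineM hs ht.
    by rewrite permM su t0.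
  by rewrite permM hl su tl.
rewrite -(crdK u) /crd; move: (u.1) (Z.of_nat u.2 + Z.b2z u.1)%Z => b z {k}.
case: b; last first.
  have [s [hs sE]] := translate_sym (- z); exists s; split=> //.
  by rewrite sE; pt_crush.
(* A y vertex is moved to level 1, where [exchange] turns (true, 1, 0) into (false, 1, 0), and then
   down to x_0. *)
have [s [hs sE]] := translate_sym (1 - z); have [t [ht tE]] := translate_sym (- 1).
exists (s * de * t)%g; split; first exact: affineM (affineM _ _ _ _ _ _ hs hde) ht.
rewrite !permM sE (_ : pt _ = pt (true, 1, 0)%Z); last by pt_crush.
by rewrite deE tE; pt_crush.
Qed.

Lemma rw_connected (P : T -> Prop) :
  P origin -> (forall v i, P v -> P (nb v i)) -> forall v, P v.
Proof.
move=> P0 PS; have Px : forall k : nat, P (pt (false, Z.of_nat k, 0)%Z).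
  elim=> [|k IH]; first exact: P0.
  have := PS _ (false, false) IH; rewrite nb_pt /nbc.
  by rewrite (_ : Z.of_nat k + 1 = Z.of_nat k.+1)%Z //; lia.
move=> v; rewrite -(crdK v) /crd; case: (v.1).
  by have := PS _ (false, true) (Px v.2); rewrite nb_pt.
by rewrite Z.add_0_r.
Qed.

(** * Colourings by levels separate the faces *)

Lemma level_pt c : exists w, level (pt c) = (c.1.2 + 3 * mZ * w)%Z.
Proof.
have := crdK (pt c); rewrite /crd; case: c => [[b k] t] /pt_inv[_ [w hw] _].
by exists w; move: hw; rewrite -/(level _) /=; lia.
Qed.

Lemma level_mod N c : (Z.of_nat N | 3 * mZ)%Z ->
  (level (pt c) mod Z.of_nat N = c.1.2 mod Z.of_nat N)%Z.
Proof.
case=> q hq; have [w ->] := level_pt c; rewrite hq.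
by rewrite (_ : q * Z.of_nat N * w = (q * w) * Z.of_nat N)%Z ?Z_mod_plus_full //; lia.
Qed.

Lemma nb_rev_dir v i : nb (nb v i) (rev_dir v.1 i) = v.
Proof.
rewrite -{1 3}(crdK v) !nb_pt /crd; move: (v.1) (Z.of_nat _ + _)%Z => b k.
by case: b i => [] [[] []]; pt_crush.
Qed.

Lemma residue_separated N (tau : Z -> dir) col (type : T -> dir) :
  0 < N -> (Z.of_nat N | 3 * mZ)%Z -> residue_coloring N tau col ->
  (forall v, type v = tau (level v mod Z.of_nat N)%Z) -> separated n nb type.
Proof.
move=> N0 Nm hc typeE; pose res v := (level v mod Z.of_nat N)%Z.
have check v i :
    [/\ col v.1 (res v) (dadd i (tau (res v))) = col v.1 (res v) i,
       forall j, col v.1 (res v) i = col v.1 (res v) j -> j = i \/ j = dadd i (tau (res v)) &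
       let: (b', k', _) := nbc (v.1, res v, 0%Z) i in
       col b' (k' mod Z.of_nat N)%Z (rev_dir v.1 i) = col v.1 (res v) i].
  have := hc; rewrite /residue_coloring => /allP/(_ v.1).
  rewrite !inE; have -> : (v.1 == false) || (v.1 == true) by case: (v.1).
  move/(_ isT)/allP/(_ (Z.to_nat (res v))).
  have rb : (0 <= res v < Z.of_nat N)%Z by apply: Z.mod_pos_bound; lia.
  rewrite mem_iota; have -> : 0 <= Z.to_nat (res v) < 0 + N by lia.
  move/(_ isT)/all_dirs/(_ i); rewrite Z2Nat.id; last by lia.
  case/and3P=> /eqP h1 /all_dirs h2 h3; split=> //.
    by move=> j e; have := h2 j; rewrite e eqxx /= => /orP[] /eqP; [left|right].
  by case: (nbc _ i) h3 => [[b' k'] t'] /eqP.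
apply: (coloring_separated n nb nb_inj nb_neq _ _ (fun v i => col v.1 (res v) i)).
- move=> v i j e.
  have -> : j = rev_dir v.1 i by apply: (nb_inj (nb v i)); rewrite e nb_rev_dir.
  have [_ _] := check v i; have := level_mod N (nbc (crd v) i) Nm; rewrite -/(nb v i) /res => ->.
  have -> : (nb v i).1 = (nbc (crd v) i).1.1 by rewrite /nb; case: (nbc _ i) => [[]].
  have shift : ((nbc (crd v) i).1.2 mod Z.of_nat N = (nbc (v.1, level v mod Z.of_nat N, 0) i).1.2 mod Z.of_nat N)%Z.
    rewrite /crd -/(level v); case: (v.1) i {e} => [] [[] []] /=;
      by rewrite ?Zminus_mod_idemp_l ?Zplus_mod_idemp_l.
  rewrite shift; have -> : (nbc (crd v) i).1.1 = (nbc (v.1, level v mod Z.of_nat N, 0)%Z i).1.1.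
    by rewrite /crd; case: (v.1) i {e shift} => [] [[] []].
  by case: (nbc (v.1, _, _) i) => [[b' k'] t'].
- by move=> v i; rewrite typeE; case: (check v i).
by move=> v i j e; rewrite typeE; case: (check v i) => _ h _; apply: h.
Qed.

(** * Walk counts single out the pairing of up with up *)

Fixpoint walks (l : nat) (u w : T) : nat :=
  if l is l'.+1 then sumn [seq walks l' (nb u i) w | i <- dirs] else u == w.

Lemma walks_aut (s : {perm T}) l u w : graph_aut n a r s -> walks l (s u) (s w) = walks l u w.
Proof.
move=> hs; elim: l u => [|l IH] u; first by rewrite /= (inj_eq perm_inj).
have E : perm_eq [seq nb (s u) i | i <- dirs] [seq s (nb u i) | i <- dirs].
  have sub (x y : T) : rw_adj n a r x y -> exists2 i, i \in dirs & y = nb x i.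
    by case/(adjP n a r nb rw_adjE)=> i ->; exists i => //; move: i; apply: all_dirs.
  apply: uniq_perm => [||x]; first by rewrite (map_inj_uniq (nb_inj _)).
    by rewrite (map_inj_uniq (f := fun i => s (nb u i))) // => i j /perm_inj/nb_inj.
  apply/mapP/mapP => [[i _ ->]|[i _ ->]].
    have : rw_adj n a r (s^-1%g (s u)) (s^-1%g (nb (s u) i)).
      by rewrite (graph_autV n a r s hs) adj_nb //; apply: rw_adjE.
    by rewrite permK => /sub[j jd e]; exists j => //; rewrite -e permKV.
  by apply: sub; rewrite hs adj_nb //; apply: rw_adjE.
have := perm_sumn (perm_map (fun x => walks l x (s w)) E).
by rewrite -!map_comp /= !IH.
Qed.

Lemma walks_pt l c c' : walks l (pt c) (pt c') = walks_coord (fun x y => pt x == pt y) l c c'.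
Proof. by elim: l c => [//|l IH] c; rewrite /= !nb_pt !IH. Qed.

Lemma eq_walks_coord (e1 e2 : rel coord) l c c' :
  (forall x, (Z.abs (x.1.2 - c.1.2) <= Z.of_nat l)%Z -> e1 x c' = e2 x c') ->
  walks_coord e1 l c c' = walks_coord e2 l c c'.
Proof.
elim: l c => [|l IH] c h /=; first by rewrite h // Z.sub_diag.
do 4?[congr (_ + _)]; rewrite // IH // => x hx; apply: h; move: hx;
  by case: c => [[[] k] t] /=; lia.
Qed.

Lemma eq_mod_pt M D c c' : mZ = M -> dZ = D -> (pt c == pt c') = eq_mod M D c c'.
Proof.
move=> <- <-; case: c c' => [[b k] t] [[b' k'] t']; apply/eqP/andP=> [/vx_eq[-> [w hw]]|[/eqP-> /Z.eqb_eq h]].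
  split=> //; apply/Z.eqb_eq/Z.mod_divide; first by lia.
  by exists w; lia.
have [w hw] : (12 * mZ | k - Z.b2z b' + 3 * dZ * t - (k' - Z.b2z b' + 3 * dZ * t'))%Z.
  by apply/Z.mod_divide; first by lia.
by apply/vx_eq; split=> //; exists w; lia.
Qed.

Lemma eqc_pt c c' : (Z.abs (c.1.2 - c'.1.2) < 3 * mZ)%Z -> (pt c == pt c') = eqc c c'.
Proof.
move=> small; apply/eqP/idP => [e|/(eqc_base 0)]; last first.
  by case: c c' {small} => [[b k] t] [[b' k'] t'].
case: c c' small e => [[b k] t] [[b' k'] t'] small e.
have {}small : (Z.abs (k - k') < 3 * mZ)%Z by [].
have [_ [w hw] _] := pt_inv _ _ _ _ _ _ e.
have kk : k = k' by have [?|[?|?]] : (w = 0 \/ 1 <= w \/ w <= -1)%Z; [lia|subst w; lia|nia|nia].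
by apply: (base_eqc 0) => //; rewrite /= kk Z.eqb_refl orbT.
Qed.

(* For 3 <= m there are 160 walks of length 6 between the two vertices if
   t = (false, true) and 150 otherwise; for m <= 2 there are 12 walks of length 4
   if t = (false, true) and 13 or 15 otherwise. *)
Lemma walks_level : exists l, forall t, t != (false, false) -> t != (false, true) ->
  walks l (nb origin (false, false)) (nb origin t) <>
  walks l (nb origin (false, false)) (nb origin (false, true)).
Proof.
pose o : coord := (false, 0, 0)%Z.
have [m3|m3] := leqP 3 m.
  exists 6 => t t0 t1; rewrite !nb_pt !walks_pt.
  have red t' : walks_coord (fun x y => pt x == pt y) 6 (nbc o (false, false)) (nbc o t')
      = walks_coord eqc 6 (nbc o (false, false)) (nbc o t').
    (* A walk of length 6 from level 1 stays between levels -5 and 7, hence within 8 of the final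
       level, which is 1 or -1. This is less than 3m because m is at least 3. *)
    apply: eq_walks_coord => x hx; apply: eqc_pt; move: hx.
    by case: t' => [[] []] /=; lia.
  by rewrite !red; case: t t0 t1 => [[] []] // _ _; vm_compute.
exists 4 => t t0 t1; rewrite !nb_pt !walks_pt.
have red M D t' : mZ = M -> dZ = D ->
    walks_coord (fun x y => pt x == pt y) 4 (nbc o (false, false)) (nbc o t')
      = walks_coord (eq_mod M D) 4 (nbc o (false, false)) (nbc o t').
  by move=> e1 e2; apply: eq_walks_coord => x _; apply: eq_mod_pt.
have [m1|m2] : (mZ = 1 \/ mZ = 2)%Z by lia.
  have [d1|d1] : (dZ = 1 \/ dZ = 11)%Z by case: dE; lia.
    by rewrite !(red _ _ _ m1 d1); case: t t0 t1 => [[] []] // _ _; vm_compute.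
  by rewrite !(red _ _ _ m1 d1); case: t t0 t1 => [[] []] // _ _; vm_compute.
have [d2|d2] : (dZ = 2 \/ dZ = 22)%Z by case: dE; lia.
  by rewrite !(red _ _ _ m2 d2); case: t t0 t1 => [[] []] // _ _; vm_compute.
by rewrite !(red _ _ _ m2 d2); case: t t0 t1 => [[] []] // _ _; vm_compute.
Qed.

(** By arc-transitivity under translations, the number of walks between two neighbours of a vertex
    depends only on the difference of their directions. By [walks_level] this number characterises
    (0,1) among the nonzero differences. *)
Lemma aut_level (s : {perm T}) v i j : graph_aut n a r s ->
  s (nb v i) = nb (s v) j ->
  s (nb v (dadd i (false, true))) = nb (s v) (dadd j (false, true)).
Proof.
move=> hs hj; have [l hl] := walks_level.
have type u k t : walks l (nb u k) (nb u (dadd k t)) =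
    walks l (nb origin (false, false)) (nb origin t).
  have [g [hg gu gk]] := arc_trans u k origin (false, false).
  rewrite -(walks_aut g); last exact: affine_aut rw_adjE _ _ hg.
  congr walks; first exact: gk.
  have [c hc] := hg u; rewrite hc shear0 daddA gu; congr nb.
  move: gk; rewrite hc shear0 gu => /nb_inj ->.
  by case: t => [].
have : rw_adj n a r (s v) (s (nb v (dadd i (false, true)))).
  by rewrite hs adj_nb //; apply: rw_adjE.
case/(adjP n a r nb rw_adjE)=> k ek; rewrite ek; congr nb.
have e : walks l (nb (s v) j) (nb (s v) (dadd j (dadd j k))) =
    walks l (nb origin (false, false)) (nb origin (false, true)).
  by rewrite daddKl -ek -hj walks_aut // type.
rewrite type in e.
have [jk|jk] := eqVneq (dadd j k) (false, true); first by rewrite -jk daddKl.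
case: (hl (dadd j k)) => //; apply: contraPneq ek => jk0.
have kj : k = j by case: j k jk0 {hj e jk} => [[] []] [[] []].
rewrite kj -hj => /perm_inj/nb_inj/esym/eqP; apply/negP.
by rewrite eq_sym; case: i {hj} => [[] []].
Qed.

(** * Automorphisms fixing an arc *)

Section Rigidity.

Variable s : {perm T}.
Hypothesis s_aut : graph_aut n a r s.
Hypothesis s_origin : s origin = origin.
Hypothesis s_first : s (nb origin (false, false)) = nb origin (false, false).

Local Notation "c ~> c'" := (s (pt c) = pt c') (at level 70).

Lemma maps_flip c c' i j : c ~> c' -> nbc c i ~> nbc c' j ->
  nbc c (dadd i (false, true)) ~> nbc c' (dadd j (false, true)).
Proof. by rewrite -!nb_pt => <-; apply: aut_level. Qed.

Lemma maps_nb c c' i : c ~> c' -> exists j, nbc c i ~> nbc c' j.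
Proof.
move=> e; have : rw_adj n a r (s (pt c)) (s (nb (pt c) i)).
  by rewrite s_aut adj_nb //; apply: rw_adjE.
by case/(adjP n a r nb rw_adjE)=> j; rewrite e !nb_pt => ej; exists j.
Qed.

Lemma maps_up c c' j : c ~> c' -> nbc c (true, false) ~> nbc c' (true, j) ->
  exists k, nbc c (false, false) ~> nbc c' (false, k).
Proof.
move=> e e1; have e2 := maps_flip _ _ _ _ e e1; have [[p q] e3] := maps_nb _ _ (false, false) e.
suff p0 : p = false by subst p; exists q.
apply/negP=> p1; rewrite p1 -!nb_pt in e1 e2 e3.
have [qj|qj] := eqVneq q j.
  by have /perm_inj/nb_inj := etrans e1 (esym (etrans e3 (congr1 (fun x => nb _ (true, x)) qj))).
have qj' : q = ~~ j by case: q j qj {e1 e2 e3} => [] [].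
have /perm_inj/nb_inj // : s (nb (pt c) (dadd (true, false) (false, true))) = s (nb (pt c) (false, false)).
by rewrite e2 e3 qj' /dadd /= addbT.
Qed.

Lemma maps_eq c c' u u' : u ~> u' -> pt u = pt c -> pt u' = pt c' -> c ~> c'.
Proof. by move=> + <- <-. Qed.

(* The image of one edge of an octagon between two consecutive levels determines
   the image of the octagon. *)
Lemma maps_octagon k t h :
  (true, k, t)%Z ~> (true, k, t + h)%Z ->
  (true, k + 1, t - 1)%Z ~> (true, k + 1, t - 1 + h)%Z ->
  [/\ (false, k, t - 1)%Z ~> (false, k, t - 1 + h)%Z,
      (true, k, t - 2)%Z ~> (true, k, t - 2 + h)%Z &
      (true, k + 1, t - 2 - 1)%Z ~> (true, k + 1, t - 2 - 1 + h)%Z].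
Proof.
move=> e1 e2.
have e3 : (false, k, t - 1)%Z ~> (false, k, t - 1 + h)%Z.
  have := maps_flip _ _ (true, true) (true, true) e2; move/(_ _)/maps_eq; apply; try pt_crush.
  by apply: maps_eq e1 _ _; pt_crush.
have e4 : (false, k + 1, t - 1)%Z ~> (false, k + 1, t - 1 + h)%Z.
  have := maps_flip _ _ (false, true) (false, true) e3; move/(_ _)/maps_eq; apply; try pt_crush.
  by apply: maps_eq e2 _ _; pt_crush.
have e5 : (true, k, t - 2)%Z ~> (true, k, t - 2 + h)%Z.
  have := maps_flip _ _ (true, false) (true, false) e4; move/(_ _)/maps_eq; apply; try pt_crush.
  by apply: maps_eq e3 _ _; pt_crush.
split=> //; have := maps_flip _ _ (false, true) (false, true) e5; move/(_ _)/maps_eq; apply; try pt_crush.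
by apply: maps_eq e4 _ _; pt_crush.
Qed.

Lemma maps_x0 : (false, 0, 0)%Z ~> (false, 0, 0)%Z.
Proof. exact: s_origin. Qed.

Lemma maps_x1 : (false, 1, 0)%Z ~> (false, 1, 0)%Z.
Proof. by move: s_first; rewrite nb_pt. Qed.

(** The octagon through x_0 and x_1 between levels 0 and 1 is fixed. It contains half of the
    vertices of level 0. *)
Lemma maps_octagons : 
  [/\ (true, 0, -1)%Z ~> (true, 0, -1)%Z, (true, 0, -3)%Z ~> (true, 0, -3)%Z &
      (false, 0, -2)%Z ~> (false, 0, -2)%Z].
Proof.
have y1 : (true, 0, -1)%Z ~> (true, 0, -1)%Z.
  have := maps_flip _ _ (true, false) (true, false) maps_x1.
  by move/(_ _)/maps_eq; apply; try pt_crush; apply: maps_eq maps_x0 _ _; pt_crush.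
have y2 : (true, 1, -2)%Z ~> (true, 1, -2)%Z.
  have := maps_flip _ _ (false, true) (false, true) y1.
  by move/(_ _)/maps_eq; apply; try pt_crush; apply: maps_eq maps_x1 _ _; pt_crush.
have [x2 y3 _] := maps_octagon 0 (-1) 0 y1 y2.
by split.
Qed.

(** The two lower neighbours of x_0 are either both fixed or exchanged. Going back up from x_{-1},
    this decides the image of y_{-1} = (true, 0, 0), a vertex of the other octagon. *)
Lemma maps_down : exists h, (h = 0 \/ h = -2)%Z /\
  (true, 0, 0)%Z ~> (true, 0, h)%Z /\
  exists j, nbc (true, 0, 0)%Z (true, false) ~> nbc (true, 0, h)%Z (true, j).
Proof.
have xd : exists j, nbc (false, 0, 0)%Z (true, false) ~> nbc (false, 0, 0)%Z (true, j).
  have [[p j] e] := maps_nb _ _ (true, false) maps_x0.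
  case: p e => e; first by exists j.
  have e1 : nbc (false, 0, 0)%Z (false, false) ~> nbc (false, 0, 0)%Z (false, false).
    exact: maps_x1.
  have e2 := maps_flip _ _ _ _ maps_x0 e1.
  have e3 : s (nb origin (true, false)) = s (nb origin (false, j)).
    rewrite {1}nb_pt e; case: (j) => /=; first by rewrite -[RHS]/(s (nb (pt _) _)) nb_pt e2.
    by rewrite s_first nb_pt.
  by have /perm_inj/nb_inj := e3.
case: xd => [[]] e.
  exists (-2)%Z; split; first by right.
  have e1 : nbc (false, -1, 0)%Z (false, false) ~> nbc (true, -1, -1)%Z (false, true).
    by apply: maps_eq maps_x0 _ _; pt_crush.
  have y0 : (true, 0, 0)%Z ~> (true, 0, -2)%Z.
    have e0 : (false, -1, 0)%Z ~> (true, -1, -1)%Z by apply: maps_eq e _ _; pt_crush.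
    have := maps_flip _ _ _ _ e0 e1.
    by move/maps_eq; apply; pt_crush.
  split=> //; exists true; apply: maps_eq e _ _; pt_crush.
exists 0%Z; split; first by left.
have e1 : nbc (false, -1, 0)%Z (false, false) ~> nbc (false, -1, 0)%Z (false, false).
  by apply: maps_eq maps_x0 _ _; pt_crush.
have y0 : (true, 0, 0)%Z ~> (true, 0, 0)%Z.
  have e0 : (false, -1, 0)%Z ~> (false, -1, 0)%Z by apply: maps_eq e _ _; pt_crush.
  have := maps_flip _ _ _ _ e0 e1.
  by move/maps_eq; apply; pt_crush.
split=> //; exists false; apply: maps_eq e _ _; pt_crush.
Qed.

Lemma maps_layer0 :
  (forall b t, (b, 0, t)%Z ~> (b, 0, t)%Z) \/ (forall b t, (b, 0, t)%Z ~> twist (b, 0, t)%Z).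
Proof.
have [h [hh [y0 [j yd]]]] := maps_down; have [y1 y3 x2] := maps_octagons.
have [q yu] := maps_up _ _ _ y0 yd.
have x1d : nbc (false, 1, 0)%Z (true, false) ~> nbc (false, 1, 0)%Z (true, false).
  by apply: maps_eq maps_x0 _ _; pt_crush.
have [q' xu] := maps_up _ _ _ maps_x1 x1d.
(* The vertex (true, 1, -1) is adjacent to x_2, whose image is an upper neighbour of x_1. The other
   candidate for its image is adjacent to no such vertex. *)
have yu' : (true, 1, -1)%Z ~> (true, 1, -1 + h)%Z.
  case: q yu => yu; last by apply: maps_eq yu _ _; pt_crush.
  have : nbc (nbc (false, 1, 0)%Z (false, false)) (true, true) ~> nbc (true, 0, h)%Z (false, true).
    by apply: maps_eq yu _ _; pt_crush.
  have [l xl] := maps_nb _ _ (true, true) xu.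
  rewrite xl => e; exfalso; clear y0 yd yu xl xu.
  case: hh => hh; subst h; case: q' l e => [] [[] []] e;
    by match type of e with pt ?x = pt ?y => have := base_eqc 0 x y isT e end.
have [x1 y2 y2u] := maps_octagon 0 0 h y0 yu'.
have [x3 _ _] := maps_octagon 0 (-2) h y2 y2u.
have all4 f : (forall b t t', (exists u, t = t' + 4 * u)%Z -> pt (f (b, 0, t)%Z) = pt (f (b, 0, t')%Z)) ->
    (forall b, (b, 0, 0)%Z ~> f (b, 0, 0)%Z) -> (forall b, (b, 0, -1)%Z ~> f (b, 0, -1)%Z) ->
    (forall b, (b, 0, -2)%Z ~> f (b, 0, -2)%Z) -> (forall b, (b, 0, -3)%Z ~> f (b, 0, -3)%Z) ->
    forall b t, (b, 0, t)%Z ~> f (b, 0, t)%Z.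
  move=> hf f0 f1 f2 f3 b t.
  have key t' : (exists u, t = t' + 4 * u)%Z -> (b, 0, t')%Z ~> f (b, 0, t')%Z -> (b, 0, t)%Z ~> f (b, 0, t)%Z.
    by move=> ht e; rewrite (hf b t t' ht) -e (pt_eq b _ _ _ ht).
  have := Z.div_mod t 4; have := Z.mod_pos_bound t 4.
  move: (t / 4)%Z (t mod 4)%Z => u v h1 h2.
  have [v0|[v1|[v2|v3]]] : (v = 0 \/ v = 1 \/ v = 2 \/ v = 3)%Z by lia.
  - by apply: (key 0%Z) => //; exists u; lia.
  - by apply: (key (-3)%Z) => //; exists (u + 1)%Z; lia.
  - by apply: (key (-2)%Z) => //; exists (u + 1)%Z; lia.
  by apply: (key (-1)%Z) => //; exists (u + 1)%Z; lia.
case: hh => hh; subst h; [left|right].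
  apply: (all4 id) => [b t t' [u ht]|[]|[]|[]|[]]; first by apply: pt_eq; exists u.
  - exact: y0.
  - exact: maps_x0.
  - exact: y1.
  - exact: x1.
  - by apply: maps_eq y2 _ _; pt_crush.
  - exact: x2.
  - exact: y3.
  - exact: x3.
have tw0 b t : twist (b, 0, t)%Z = (b, 0, (if b then 2 else 0) - t)%Z by case: b.
apply: (all4 twist) => [b t t' [u ht]|[]|[]|[]|[]]; rewrite !tw0.
- by case: b; apply: pt_eq; exists (- u)%Z; lia.
- by apply: maps_eq y0 _ _; pt_crush.
- by apply: maps_eq maps_x0 _ _; pt_crush.
- by apply: maps_eq y1 _ _; pt_crush.
- by apply: maps_eq x1 _ _; pt_crush.
- by apply: maps_eq y2 _ _; pt_crush.
- by apply: maps_eq x2 _ _; pt_crush.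
- by apply: maps_eq y3 _ _; pt_crush.
by apply: maps_eq x3 _ _; pt_crush.
Qed.

(** Induction on the level: a vertex is a common neighbour of its two lower neighbours, and without
    4-cycles it is the only one. Its image is therefore forced by theirs, and [f], which respects
    adjacency, gives the same vertex. *)
Lemma maps_levels f L :
  (forall c, exists k, forall i, pt (f (nbc c i)) = pt (nbc (f c) (dadd k (shear L i)))) ->
  (forall b t, (b, 0, t)%Z ~> f (b, 0, t)%Z) ->
  forall (k : nat) b t, (b, Z.of_nat k, t) ~> f (b, Z.of_nat k, t).
Proof.
move=> hf f0; elim=> [|k IH] b t; first exact: f0.
set c := (b, _, _).
have down j : nbc c (true, j) ~> f (nbc c (true, j)).
  have e : (Z.of_nat k.+1 - 1 = Z.of_nat k)%Z by lia.
  have [b' [t' ->]] : exists b' t', nbc c (true, j) = (b', Z.of_nat k, t').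
    by rewrite /c /nbc e; case: b j {c} => [] []; do 2!eexists.
  exact: IH.
have [l hl] := hf c.
have back j : exists i, nb (s (pt (nbc c (true, j)))) i = s (pt c).
  have : rw_adj n a r (s (pt (nbc c (true, j)))) (s (pt c)).
    by rewrite s_aut rw_adj_sym -nb_pt adj_nb //; apply: rw_adjE.
  by case/(adjP n a r nb rw_adjE)=> i ->; exists i.
have back' j : exists i, nb (s (pt (nbc c (true, j)))) i = pt (f c).
  rewrite down hl -nb_pt.
  by have [i hi] := nb_rev _ _ _ nb rw_adjE (pt (f c)) (dadd l (shear L (true, j))); exists i.
have [i0 h0] := back false; have [i1 h1] := back' false.
have [j0 g0] := back true; have [j1 g1] := back' true.
have [i2 h2] := nb_rev _ _ _ nb rw_adjE (s (pt (nbc c (true, true)))) j0.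
have [i3 h3] := nb_rev _ _ _ nb rw_adjE (s (pt (nbc c (true, true)))) j1.
rewrite -h0 -h1; apply: (common_nb _ (s (pt (nbc c (true, true)))) _ _ i2 i3).
- by rewrite h0 -g0.
- by rewrite h1 -g1.
by move/perm_inj; rewrite -!nb_pt => /nb_inj.
Qed.

Lemma rigidity : s = 1%g \/ forall (k : nat) b t, (b, Z.of_nat k, t) ~> twist (b, Z.of_nat k, t).
Proof.
have [h|h] := maps_layer0; [left|right].
  apply/permP=> v; rewrite perm1 -(crdK v) /crd.
  rewrite (_ : Z.of_nat v.2 + Z.b2z v.1 = Z.of_nat (v.2 + v.1))%Z; last by case: (v.1); lia.
  apply: (maps_levels id false) => // c; exists (false, false) => i.
  by rewrite shear0; case: i => [[] []].
by apply: (maps_levels twist true) => //; apply: twist_nbc.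
Qed.

End Rigidity.

Lemma twist_period (s : {perm T}) :
  (forall (k : nat) b t, s (pt (b, Z.of_nat k, t)) = pt (twist (b, Z.of_nat k, t))) -> m %% 4 = 2.
Proof.
(* The vertex x_{3d} can be written at level 3d with t = 0 or at level 0 with t = 1. The two values
   of [twist] have t = d + 1 and t = -1 when read at level 0. *)
move=> hs; have e1 := hs (3 * d)%N false 0%Z; have e0 := hs 0%N false 1%Z.
have tw : twist (false, Z.of_nat (3 * d), 0)%Z = (false, Z.of_nat (3 * d), dZ - 0)%Z.
  by rewrite (_ : Z.of_nat (3 * d) = 3 * dZ + 0)%Z; [rewrite /twist mod3E // div3E|lia].
have shift t : pt (false, Z.of_nat (3 * d), t) = pt (false, 0, t + 1)%Z.
  by apply/vx_eq; split=> //; exists 0%Z; lia.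
rewrite tw !shift in e1.
have [_ _ /(_ erefl)[u hu]] := pt_inv _ _ _ _ _ _ (etrans (esym e1) e0).
have : exists q, d = (q * 4 + 2)%N.
  by exists (Z.to_nat (u - 1)); move: hu; rewrite /twist -[(0 / 3)%Z]/0%Z; lia.
case=> q dq; case: dE => dm; first by rewrite -dm dq modnMDl.
have := divn_eq m 4; have := ltn_pmod m (isT : 0 < 4).
by move: (m %/ 4) (m %% 4) => x y; lia.
Qed.

(** Composing with an automorphism acting by translations makes [s] fix the arc from x_0 to x_1;
    [rigidity] leaves the identity or the twist. *)
Lemma aut_normal_form (s : {perm T}) : graph_aut n a r s ->
  affine n nb false s \/ (m %% 4 = 2 /\ affine n nb true s).
Proof.
move=> hs; have : rw_adj n a r (s origin) (s (nb origin (false, false))).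
  by rewrite hs adj_nb //; apply: rw_adjE.
case/(adjP n a r nb rw_adjE)=> j ej.
have [g [hg g0 g1]] := arc_trans (s origin) j origin (false, false).
have sg : s = ((s * g) * g^-1)%g by rewrite mulgK.
have hsg : graph_aut n a r (s * g)%g.
  by apply: graph_autM => //; apply: affine_aut rw_adjE _ _ hg.
have [||e|e] := rigidity _ hsg; first by rewrite permM.
- by rewrite permM ej.
- by left; rewrite sg e mul1g; apply: affineV.
right; have m4 := twist_period _ e; split=> //.
have [tw [htw twE]] := twist_sym m4.
have -> : s = (tw * g^-1)%g.
  rewrite sg; congr (_ * _)%g; apply/permP=> v; rewrite -(crdK v) /crd.
  rewrite (_ : Z.of_nat v.2 + Z.b2z v.1 = Z.of_nat (v.2 + v.1))%Z; last by case: (v.1); lia.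
  by rewrite e twE.
exact: affineM htw (affineV _ _ _ _ hg).
Qed.

(** * The number of maps in each residue class *)

Lemma three_maps : m %% 4 != 2 -> exactly_k_class2_01_maps n a r 3.
Proof.
move=> m4; apply: (rigid_count n a r nb rw_adjE nb_inj nb_neq origin arc_trans).
  have N3 : (Z.of_nat 3 | 3 * mZ)%Z by exists mZ; lia.
  case=> [[] []] // _.
  - exact: (residue_separated 3 _ _ _ isT N3 color_hubP).
  - exact: (residue_separated 3 _ _ _ isT N3 color_rimP).
  exact: (residue_separated 3 _ _ _ isT N3 color_levelP).
move=> s /aut_normal_form[//|[e]]; by rewrite e in m4.
Qed.

Lemma two_maps : m %% 4 = 2 -> exactly_k_class2_01_maps n a r 2.
Proof.
move=> m4; have [tw [htw twE]] := twist_sym m4.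
have N3 : (Z.of_nat 3 | 3 * mZ)%Z by exists mZ; lia.
have [q mq] : exists q, mZ = (2 * q)%Z.
  have := divn_eq m 4; rewrite m4 => hm; exists (2 * Z.of_nat (m %/ 4) + 1)%Z; lia.
(* As m is even, the level has a well-defined parity, which gives the bipartition. Combined with the
   residue modulo 3, it allows colourings modulo 6. *)
have N6 : (Z.of_nat 6 | 3 * mZ)%Z by exists q; lia.
have odd_mod k : Z.odd (k mod 6) = Z.odd k.
  have := Z.div_mod k 6; move: (k / 6)%Z (k mod 6)%Z => x y ->; last by [].
  by rewrite (_ : 6 * x + y = y + 2 * (3 * x))%Z ?Z.odd_add_mul_2 //; lia.
apply: (flip_count n a r nb rw_adjE nb_inj nb_neq origin rw_connected arc_trans
          (fun v => Z.odd (level v)) _ _ _ _ tw (false, false) htw).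
- move=> v i; have [w hw] := level_pt (nbc (crd v) i); rewrite -/(nb v i) in hw.
  rewrite hw mq (_ : 3 * (2 * q) * w = 2 * (3 * q * w))%Z; last by lia.
  rewrite Z.odd_add_mul_2 /crd -/(level v); move: (level v) => k.
  by case: (v.1) i {hw} => [] [[] []]; rewrite /= ?Z.odd_sub ?Z.odd_add /=; case: (Z.odd k).
- exact: (residue_separated 3 _ _ _ isT N3 color_levelP).
- case.
    by apply: (residue_separated 6 _ _ _ isT N6 color_mixedP) => v; rewrite odd_mod.
  exact: (residue_separated 3 _ _ _ isT N3 color_rimP).
- by move=> s /aut_normal_form[h|[_ h]]; [exists false|exists true].
- by rewrite twE.
by rewrite !nb_pt twE.
Qed.

End Family.

Theorem theorem3p8 (m d : nat) :
  1 <= m -> (d = m \/ d = 11 * m) ->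
  (m %% 4 != 2 ->
     exactly_k_class2_01_maps (12 * m) ((3 * d + 2) %% (12 * m)) ((9 * d + 1) %% (12 * m)) 3) /\
  (m %% 4 = 2 ->
     exactly_k_class2_01_maps (12 * m) ((3 * d + 2) %% (12 * m)) ((9 * d + 1) %% (12 * m)) 2).
Proof.
by move=> m1 dE; split=> m4; [apply: three_maps|apply: two_maps].
Qed.
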